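(* Let $p$ be a prime number, let $s$ be a positive integer not divisible by $p$, and let $\bar f\in\mathbb{F}_p[X]$ be a monic irreducible factor of the image of the cyclotomic polynomial $\Phi_s$ in $\mathbb{F}_p[X]$, of degree $d$. Let $n$ be a positive integer. Let $F\in\mathbb{Z}_p[X]$ be a monic polynomial with $F\bmod p=\bar f$, put $A:=\mathbb{Z}_p[X]/(F)$, let $\alpha_0$ be the image of $X$ in $A$, and for $i=1,2,\ldots,n$ let $\alpha_i\in A$ be any element satisfying $$\alpha_i\equiv\alpha_{i-1}-\frac1s\,(\alpha_{i-1}^s-1)\,\alpha_{i-1}\,(2-\alpha_{i-1}^s)\pmod{p^{2^i}A}.$$ Put $\alpha=\alpha_n$. Then the polynomial $$(Y-\alpha)(Y-\alpha^p)\cdots(Y-\alpha^{p^{d-1}})\in A[Y]$$ is congruent modulo $p^{2^n}A[Y]$ to $\tilde f(Y)$, where $\tilde f\in\mathbb{Z}_p[X]$ is the unique monic factor of $\Phi_s$ in $\mathbb{Z}_p[X]$ whose reduction modulo $p$ is $\bar f$. Moreover, $\alpha$ can be computed in this way in $O(d^2 n\log s)$ arithmetic operations in $\mathbb{Q}_p$, the powers $\alpha^p,\alpha^{p^2},\ldots,\alpha^{p^{d-1}}$ can then be computed in $O(d^3\log p)$ further operations, and the product can be expanded modulo $p^{2^n}$ in $O(d^3\log d)$ further operations.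
   Context: $\mathbb{Z}_p$ is the ring of $p$-adic integers, $\mathbb{Q}_p$ its fraction field, $\mathbb{F}_p=\mathbb{Z}_p/p\mathbb{Z}_p$, and $\Phi_s$ is the $s$-th cyclotomic polynomial. Since $p\nmid s$, $\bar f$ is a simple factor of the reduction of $\Phi_s$, so by Hensel's lemma it lifts uniquely to a monic factor $\tilde f$ of $\Phi_s$ over $\mathbb{Z}_p$. Complexity is counted in arithmetic operations in $\mathbb{Q}_p$ (unit cost each). Elements of $A$ are represented by their $d$ coordinates in the basis $1,X,\ldots,X^{d-1}$, and one multiplication in $A$ costs $O(d^2)$ operations when done naively. In the $O$-bounds, logarithms are read as $\max(1,\log(\cdot))$. *)

(* Defs.v *)
From HB Require Import structures.
From mathcomp Require Import all_boot all_order all_algebra all_field.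
From mathcomp Require Import boolp reals exp.

Set Implicit Arguments.
Unset Strict Implicit.
Unset Printing Implicit Defensive.
Import Order.TTheory GRing.Theory Num.Theory.
Local Open Scope ring_scope.

(* The ring of p-adic integers is the inverse limit of the rings Z/p^k, the    *)
(* residue mod p^k being stored as its representative in [0, p^k[: the         *)
(* coherence condition at k forces x k = x (k+1) mod p^k and 0 <= x k < p^k.   *)
(* The type is indexed by the proof that p is prime, so that it is always an   *)
(* integral domain and its fraction field {fraction _} always makes sense.     *)
Record padic_int (p : nat) (p_pr : prime p) := PadicInt {
  residue :> nat -> int;
  residue_coh : forall k, residue k = (residue k.+1 %% (p ^ k)%N%:Z)%Z }.

HB.instance Definition _ p (p_pr : prime p) := gen_eqMixin (padic_int p_pr).
HB.instance Definition _ p (p_pr : prime p) := gen_choiceMixin (padic_int p_pr).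

Section PadicRing.
Variables (p : nat) (p_pr : prime p).
Local Notation Zp := (padic_int p_pr).
Local Notation q k := ((p ^ k)%N%:Z).

Lemma padic_eq (x y : Zp) : (forall k, x k = y k) -> x = y.
Proof.
case: x y => [x xP] [y yP] /= /funext exy; case: _ / exy in yP *.
by congr PadicInt; apply: Prop_irrelevance.
Qed.

Lemma modz_pow k m (a : int) : (k <= m)%N -> ((a %% q m)%Z %% q k)%Z = (a %% q k)%Z.
Proof.
move=> le_km; rewrite [in RHS](divz_eq a (q m)) -(subnK le_km) expnD PoszM mulrA.
by rewrite modzMDl.
Qed.

Lemma residue_le (x : Zp) k m : (k <= m)%N -> (x m %% q k)%Z = x k.
Proof.
elim: m => [|m IHm]; first by rewrite leqn0 => /eqP->; rewrite residue_coh modz_mod.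
rewrite leq_eqVlt => /predU1P[->|]; first by rewrite residue_coh modz_mod.
by rewrite ltnS => le_km; rewrite -[RHS]IHm // (residue_coh x m) modz_pow.
Qed.

Lemma residue_mod (x : Zp) k : (x k %% q k)%Z = x k.
Proof. exact: residue_le. Qed.

Fact padic_mk_coh (u : nat -> int) :
    (forall k, (u k.+1 = u k %[mod q k])%Z) ->
  forall k, (u k %% q k)%Z = ((u k.+1 %% q k.+1)%Z %% q k)%Z.
Proof. by move=> uP k; rewrite modz_pow // uP. Qed.

Definition padic_mk u uP : Zp := PadicInt p_pr (@padic_mk_coh u uP).

Fact padic_const_coh (a : int) k : (a = a %[mod q k])%Z.
Proof. by []. Qed.

Fact padic_add_coh (x y : Zp) k : (x k.+1 + y k.+1 = x k + y k %[mod q k])%Z.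
Proof. by rewrite (residue_coh x k) (residue_coh y k) modzDm. Qed.

Fact padic_opp_coh (x : Zp) k : (- x k.+1 = - x k %[mod q k])%Z.
Proof. by rewrite (residue_coh x k) modzNm. Qed.

Fact padic_mul_coh (x y : Zp) k : (x k.+1 * y k.+1 = x k * y k %[mod q k])%Z.
Proof. by rewrite (residue_coh x k) (residue_coh y k) modzMm. Qed.

Definition padic_const (a : int) : Zp := padic_mk (padic_const_coh a).
Definition padic_add x y : Zp := padic_mk (padic_add_coh x y).
Definition padic_opp x : Zp := padic_mk (padic_opp_coh x).
Definition padic_mul x y : Zp := padic_mk (padic_mul_coh x y).

Fact padic_addA : associative padic_add.
Proof. by move=> x y z; apply: padic_eq => k /=; rewrite modzDmr modzDml addrA. Qed.

Fact padic_addC : commutative padic_add.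
Proof. by move=> x y; apply: padic_eq => k /=; rewrite addrC. Qed.

Fact padic_add0 : left_id (padic_const 0) padic_add.
Proof. by move=> x; apply: padic_eq => k /=; rewrite modzDml add0r residue_mod. Qed.

Fact padic_addN : left_inverse (padic_const 0) padic_opp padic_add.
Proof. by move=> x; apply: padic_eq => k /=; rewrite modzDml addNr. Qed.

HB.instance Definition _ :=
  GRing.isZmodule.Build Zp padic_addA padic_addC padic_add0 padic_addN.

Fact padic_mulA : associative padic_mul.
Proof. by move=> x y z; apply: padic_eq => k /=; rewrite modzMmr modzMml mulrA. Qed.

Fact padic_mulC : commutative padic_mul.
Proof. by move=> x y; apply: padic_eq => k /=; rewrite mulrC. Qed.

Fact padic_mul1 : left_id (padic_const 1) padic_mul.
Proof. by move=> x; apply: padic_eq => k /=; rewrite modzMml mul1r residue_mod. Qed.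

Fact padic_mulD : left_distributive padic_mul +%R.
Proof.
by move=> x y z; apply: padic_eq => k /=; rewrite modzMml modzDm mulrDl.
Qed.

Fact padic_1_neq0 : padic_const 1 != 0.
Proof.
apply/eqP => /(congr1 (fun x : Zp => x 1%N)) /=.
by rewrite expn1 !modz_small ?ltz_nat ?prime_gt0 ?prime_gt1.
Qed.

HB.instance Definition _ := GRing.Zmodule_isComNzRing.Build Zp
  padic_mulA padic_mulC padic_mul1 padic_mulD padic_1_neq0.

Definition padic_unit (x : Zp) : bool := `[< exists y : Zp, y * x = 1 >].
Definition padic_inv (x : Zp) : Zp :=
  if pselect (exists y : Zp, y * x = 1) is left x_unit then sval (cid x_unit)
  else x.

Fact padic_mulV : {in padic_unit, left_inverse 1 padic_inv *%R}.
Proof.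
move=> x /asboolP x_unit; rewrite /padic_inv; case: pselect => // ex.
by case: cid.
Qed.

Fact padic_unitP (x y : Zp) : y * x = 1 -> padic_unit x.
Proof. by move=> yx1; apply/asboolP; exists y. Qed.

Fact padic_inv_out : {in [predC padic_unit], padic_inv =1 id}.
Proof.
move=> x; rewrite inE => /asboolPn x_nunit.
by rewrite /padic_inv; case: pselect.
Qed.

HB.instance Definition _ := GRing.ComNzRing_hasMulInverse.Build Zp
  padic_mulV padic_unitP padic_inv_out.

Lemma padic_neq0P (x : Zp) : x != 0 -> exists k, x k != 0.
Proof.
move=> x_neq0; apply: contrapT => xP; move/eqP: x_neq0; apply.
apply: padic_eq => k /=; rewrite mod0z; apply/eqP; apply/negPn/negP => xk.
by apply: xP; exists k.
Qed.

Fact padic_integral (x y : Zp) : x * y = 0 -> (x == 0) || (y == 0).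
Proof.
move=> xy0; apply: contraT; rewrite negb_or => /andP[].
move=> /padic_neq0P[a xa] /padic_neq0P[b yb].
have p_gt1 := prime_gt1 p_pr.
have ltlog (z : Zp) m k : (k <= m)%N -> z k != 0 ->
    (0 < absz (z m))%N && (logn p (absz (z m)) < k)%N.
  move=> le_km; rewrite -(residue_le z le_km) => zk.
  have zm : (0 < absz (z m))%N.
    by rewrite absz_gt0; apply: contraNneq zk => ->; rewrite mod0z.
  rewrite zm ltnNge -pfactor_dvdn //; apply: contraNN zk => /= dv.
  by apply/eqP/dvdz_mod0P; rewrite dvdzE.
have /andP[x_gt0 x_lt] := ltlog x (a + b)%N a (leq_addr _ _) xa.
have /andP[y_gt0 y_lt] := ltlog y (a + b)%N b (leq_addl _ _) yb.
have := congr1 (fun z : Zp => z (a + b)%N) xy0; rewrite /= mod0z.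
move=> /dvdz_mod0P; rewrite dvdzE abszM /= pfactor_dvdn ?muln_gt0 ?x_gt0 //.
by rewrite lognM // leqNgt -addSn (leq_add x_lt (ltnW y_lt)).
Qed.

HB.instance Definition _ :=
  GRing.ComUnitRing_isIntegral.Build Zp padic_integral.

Definition reduction (x : Zp) : 'F_p := (x 1%N)%:~R.

Lemma intr_modp (a : int) : (a %% p)%Z%:~R = a%:~R :> 'F_p.
Proof.
rewrite [in RHS](divz_eq a p) [in RHS]intrD [in RHS]intrM -[(Posz p)%:~R]/(p%:R).
by rewrite (pcharf0 (pchar_Fp p_pr)) mulr0 add0r.
Qed.

Fact reduction_is_zmod_morphism : zmod_morphism reduction.
Proof.
move=> x y; rewrite /reduction /= expn1 intr_modp rmorphD /= intr_modp.
by rewrite rmorphN.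
Qed.

Fact reduction_is_monoid_morphism : monoid_morphism reduction.
Proof.
split=> [|x y]; first by rewrite /reduction /= expn1 intr_modp.
by rewrite /reduction /= expn1 intr_modp rmorphM.
Qed.

HB.instance Definition _ :=
  GRing.isZmodMorphism.Build Zp 'F_p reduction reduction_is_zmod_morphism.
HB.instance Definition _ :=
  GRing.isMonoidMorphism.Build Zp 'F_p reduction reduction_is_monoid_morphism.

End PadicRing.

Definition congr_mod (B : nzRingType) (m x y : B) : Prop :=
  exists z, x - y = m * z.

(* s is a unit of Z_p whenever p does not divide s, so that s^-1 below is the  *)
(* genuine inverse (for a non-unit it would be s itself).                      *)
Definition newton_seq p (p_pr : prime p) (s n : nat)
    (F : {poly padic_int p_pr}) (alpha : nat -> {poly %/ F}) : Prop :=
  alpha 0%N = 'qX /\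
  forall i, (0 < i <= n)%N ->
    let a := alpha i.-1 in
    congr_mod (p%:R ^+ (2 ^ i)) (alpha i)
      (a - (s%:R : padic_int p_pr)^-1 *: ((a ^+ s - 1) * a * (2 - a ^+ s))).

Definition conj_prod p (p_pr : prime p) (d : nat)
    (F : {poly padic_int p_pr}) (a : {poly %/ F}) : {poly {poly %/ F}} :=
  \prod_(i < d) ('X - (a ^+ (p ^ i))%:P).

Definition cyclotomic_lift p (p_pr : prime p) (s : nat) (fbar : {poly 'F_p})
    (f : {poly padic_int p_pr}) : Prop :=
  [/\ f \is monic, exists g, map_poly intr 'Phi_s = f * g
    & map_poly (@reduction p p_pr) f = fbar].

(* Straight-line programs over a field, every instruction having unit cost.   *)
(* The memory initially holds the inputs and each instruction appends one      *)
(* value. Besides the inputs only the constant 1 is available, and it is       *)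
(* charged like an operation, so no precomputed constant can be smuggled in.   *)
(* Reading an unwritten cell or dividing by 0 makes the execution fail.        *)
Inductive instr :=
  | IOne
  | IAdd of nat & nat
  | ISub of nat & nat
  | IMul of nat & nat
  | IDiv of nat & nat.

Record slp := Slp { code : seq instr; outputs : seq nat }.

Definition cost (P : slp) : nat := size (code P).

Section Exec.
Variable K : fieldType.

Definition exec_instr (mem : seq K) (c : instr) : option K :=
  let op f i j :=
    if (onth mem i, onth mem j) is (Some x, Some y) then f x y else None in
  match c with
  | IOne => Some 1
  | IAdd i j => op (fun x y => Some (x + y)) i j
  | ISub i j => op (fun x y => Some (x - y)) i j
  | IMul i j => op (fun x y => Some (x * y)) i j
  | IDiv i j => op (fun x y => if y == 0 then None else Some (x / y)) i j
  end.

Fixpoint exec (mem : seq K) (cs : seq instr) : option (seq K) :=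
  if cs is c :: cs' then
    if exec_instr mem c is Some x then exec (rcons mem x) cs' else None
  else Some mem.

Definition computes (P : slp) (input output : seq K) : Prop :=
  exists2 mem, exec input (code P) = Some mem
             & [seq onth mem i | i <- outputs P] = [seq Some y | y <- output].

End Exec.

(* The first d coefficients, in Q_p: the coordinates of an element of         *)
(* Z_p[X]/(F) in the basis 1, X, ..., X^(d-1) when d = deg F, and the         *)
(* non-leading coefficients of the monic polynomial F itself.                 *)
Definition coords p (p_pr : prime p) (d : nat) (a : {poly padic_int p_pr}) :
    seq {fraction (padic_int p_pr)} :=
  [seq FracField.tofrac a`_j | j <- iota 0 d].

Definition log_max1 (R : realType) (x : nat) : R := Num.max 1 (ln x%:R).

(* Main.v *)
Require Import Defs.
From HB Require Import structures.
From mathcomp Require Import all_boot all_order all_algebra all_field.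
From mathcomp Require Import boolp classical_sets reals exp ring zify.

Set Implicit Arguments.
Unset Strict Implicit.
Unset Printing Implicit Defensive.
Import Order.TTheory GRing.Theory Num.Theory.
Local Open Scope ring_scope.

(* Reduction mod p maps A onto the field K = F_p[X]/(fbar), with kernel p A.   *)
(* If a is congruent to X mod p, the matrix of 1, a, ..., a^(d-1) in the basis *)
(* 1, X, ..., X^(d-1) is congruent to the identity mod p, hence invertible     *)
(* over Z_p: every element of A is a unique Z_p-combination of these powers.   *)
(*   The exact Newton iterates converge to some beta with beta^s = 1 that is   *)
(* congruent to X mod p. The lift is the monic relation f of degree d of beta  *)
(* over Z_p. Write X^s - 1 = f h. For b = beta^(p^i), h(b) reduces to          *)
(* hbar(X)^(p^i) in K, which is nonzero as X^s - 1 is separable mod p; hence   *)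
(* f(b) = 0. The beta^(p^i), i < d, are distinct in K, so f is their conjugate *)
(* product. Any other Newton sequence satisfies alpha_n^s = 1 mod p^(2^n), and *)
(* alpha_n^s - beta^s = (alpha_n - beta) u with u nonzero in K, so alpha_n is  *)
(* congruent to beta mod p^(2^n).                                              *)
(*   The coefficients of the product can thus be taken constant: modulo        *)
(* p^(2^n) they are those of the degree d relation of alpha_n over Z_p, which  *)
(* Gauss-Jordan elimination finds in O(d^3) operations, without a search for   *)
(* pivots since the matrix is congruent to the identity mod p.                 *)

(** * Congruences *)

(** The ring A behaves like the integers of an unramified extension of Q_p. [residue_class] is a
    ring morphism to the field K with kernel p A, p is not a zero divisor, and A is p-adically
    separated ([quotient_separated]). So an element with nonzero class can be cancelled, even modulo
    any p^m ([congr_mod_mulI]).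

    A Newton step squares the modulus for which a^s = 1 ([newton_step_expr]), so the exact iterates
    converge to an s-th root of unity beta congruent to X ([newton_root]). Any approximate root of
    unity congruent to X is as close to beta as its s-th power is to 1 ([unity_root_congr]).

    The first d powers of an element congruent to X form a Z_p-basis of A ([power_mx_unit]). Hence
    beta has a monic relation f of degree d, and only 0 kills beta in degree below d; so f divides
    Phi_s and is the only lift of fbar. Cancelling the cofactor of f in X^s - 1 shows that f kills
    every beta^(p^i) ([ev_root_pow]); these d roots differ in K, so f is their product
    ([conj_prod_root]). [conj_prod_congr_lift] carries this from beta to alpha.

    For the costs, [computable] composes programs on a symbolic memory. The first two programs use
    Horner multiplication and binary exponentiation. The third finds a monic G of degree d with
    G(alpha) = 0 by Gauss-Jordan elimination; such a G is congruent to the conjugate product, and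
    O(d^3) operations are within the stated bound. *)

Section CongrMod.
Variable B : comNzRingType.
Implicit Types m x y z : B.

Lemma congr_mod_refl m x : congr_mod m x x.
Proof. by exists 0; rewrite subrr mulr0. Qed.

Lemma congr_mod_sym m x y : congr_mod m x y -> congr_mod m y x.
Proof. by case=> z xy; exists (- z); rewrite mulrN -xy opprB. Qed.

Lemma congr_mod_trans m x y z :
  congr_mod m x y -> congr_mod m y z -> congr_mod m x z.
Proof.
by case=> u xy [v yz]; exists (u + v); rewrite mulrDr -xy -yz addrA subrK.
Qed.

Lemma congr_modD m x y x' y' :
  congr_mod m x x' -> congr_mod m y y' -> congr_mod m (x + y) (x' + y').
Proof.
by case=> u xx' [v yy']; exists (u + v); rewrite mulrDr -xx' -yy' opprD addrACA.
Qed.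

Lemma congr_modN m x x' : congr_mod m x x' -> congr_mod m (- x) (- x').
Proof. by case=> u xx'; exists (- u); rewrite mulrN -xx' opprB opprK addrC. Qed.

Lemma congr_modB m x y x' y' :
  congr_mod m x x' -> congr_mod m y y' -> congr_mod m (x - y) (x' - y').
Proof. by move=> xx' yy'; apply: congr_modD => //; apply: congr_modN. Qed.

Lemma congr_modM m x y x' y' :
  congr_mod m x x' -> congr_mod m y y' -> congr_mod m (x * y) (x' * y').
Proof.
case=> u xx' [v yy']; exists (u * y + x' * v); rewrite mulrDr mulrA -xx'.
by rewrite mulrCA -yy' mulrBl mulrBr addrA subrK.
Qed.

Lemma congr_modX m x x' k : congr_mod m x x' -> congr_mod m (x ^+ k) (x' ^+ k).
Proof.
move=> xx'; elim: k => [|k IHk]; first exact: congr_mod_refl.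
by rewrite !exprS; apply: congr_modM.
Qed.

Lemma congr_mod_sum m (I : Type) (r : seq I) (f g : I -> B) :
  (forall i, congr_mod m (f i) (g i)) ->
  congr_mod m (\sum_(i <- r) f i) (\sum_(i <- r) g i).
Proof.
move=> fg; elim/big_rec2: _ => [|i x y _ xy]; first exact: congr_mod_refl.
exact: congr_modD.
Qed.

Lemma congr_mod_prod m (I : Type) (r : seq I) (f g : I -> B) :
  (forall i, congr_mod m (f i) (g i)) ->
  congr_mod m (\prod_(i <- r) f i) (\prod_(i <- r) g i).
Proof.
move=> fg; elim/big_rec2: _ => [|i x y _ xy]; first exact: congr_mod_refl.
exact: congr_modM.
Qed.

Lemma congr_mod_dvd m m' z x y :
  m' = m * z -> congr_mod m' x y -> congr_mod m x y.
Proof. by move=> -> [u xy]; exists (z * u); rewrite mulrA. Qed.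

Lemma congr_modXl m k l x y :
  (k <= l)%N -> congr_mod (m ^+ l) x y -> congr_mod (m ^+ k) x y.
Proof.
by move=> kl; apply: (@congr_mod_dvd _ _ (m ^+ (l - k))); rewrite -exprD subnKC.
Qed.

Lemma congr_mod_subr0 m x y : congr_mod m x y <-> congr_mod m (x - y) 0.
Proof. by rewrite /congr_mod subr0. Qed.

End CongrMod.

Lemma congr_mod_map (B B' : comNzRingType) (phi : {rmorphism B -> B'}) m x y :
  congr_mod m x y -> congr_mod (phi m) (phi x) (phi y).
Proof. by case=> z xy; exists (phi z); rewrite -rmorphB xy rmorphM. Qed.

(** * Z_p as a complete local ring *)

Section PadicIntegers.
Variables (p : nat) (p_pr : prime p).
Local Notation Zp := (padic_int p_pr).
Local Notation q k := ((p ^ k)%N%:Z).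

Lemma residue_natr n k : (n%:R : Zp) k = (n%:Z %% q k)%Z.
Proof.
elim: n => [|n IHn] //; rewrite mulrS.
have -> : ((1 + n%:R : Zp) k = ((1 : Zp) k + (n%:R : Zp) k)%R %% q k)%Z by [].
by rewrite IHn modzDml modzDmr.
Qed.

(** An element w with zero n-th residue is p^n times the element whose k-th residue is that of
    [w (k + n)] divided by p^n: dividing by p^n costs n digits of precision. *)
Lemma congr_mod_residueP n (x y : Zp) :
  congr_mod (p%:R ^+ n) x y <-> x n = y n.
Proof.
have q_neq0 k : q k != 0 by rewrite eqz_nat -lt0n expn_gt0 prime_gt0.
split=> [[z xy]|xy].
  rewrite -[x](subrK y) xy -natrX /=.
  rewrite residue_natr modzMml modzDml (_ : _ * _ = z n * q n)%R; last exact: mulrC.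
  by rewrite modzMDl residue_mod.
set w := x - y; have wn : w n = 0 by rewrite /w /= modzDmr xy subrr mod0z.
have w_dvd k : (q n %| w (k + n)%N)%Z.
  by apply/dvdz_mod0P; rewrite residue_le ?leq_addl.
pose u k := (w (k + n)%N %/ q n)%Z.
have u_coh k : (u k.+1 = u k %[mod q k])%Z.
  apply/eqP; rewrite eqz_mod_dvd -(dvdz_mul2r (q_neq0 n)) mulrBl !divzK //.
  rewrite -PoszM -expnD -eqz_mod_dvd; apply/eqP.
  by rewrite addSn residue_mod -residue_coh.
exists (padic_mk p_pr u_coh); apply: padic_eq => k.
rewrite -natrX /= residue_natr modzMml modzMmr mulrC divzK //.
by rewrite residue_le ?leq_addr.
Qed.

Lemma dvdz_Fp (a : int) : (a%:~R == 0 :> 'F_p) = (p %| a)%Z.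
Proof.
case: a => a; rewrite /intmul ?oppr_eq0 -(dvdn_pcharf (pchar_Fp p_pr)) //.
Qed.

Lemma reduction_eqP (x y : Zp) :
  reduction x = reduction y <-> congr_mod p%:R x y.
Proof.
rewrite -[p%:R]expr1 congr_mod_residueP /reduction; split=> [/eqP|->//].
rewrite -subr_eq0 -rmorphB /= dvdz_Fp -eqz_mod_dvd => /eqP.
by have := residue_mod x 1; have := residue_mod y 1; rewrite expn1 => -> ->.
Qed.

(** Bezout gives an inverse modulo each p^k; uniqueness of inverses makes them coherent. *)
Lemma padic_unit_reduction (x : Zp) : reduction x != 0 -> x \is a GRing.unit.
Proof.
move=> x_neq0.
have x_cop k : coprimez (x k) (q k).
  case: k => [|k]; first by rewrite expn0 coprimezE coprimen1.
  have : ~~ (p %| x k.+1)%Z.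
    apply: contraNN x_neq0 => /dvdz_mod0P xk; rewrite /reduction dvdz_Fp.
    by rewrite -(residue_le x (ltn0Sn k)) expn1 xk dvdz0.
  rewrite coprimezE dvdzE absz_nat => ndvd.
  by rewrite coprime_sym coprimeXl // prime_coprime.
have /choice[u uP] k : exists u : int, (u * x k = 1 %[mod q k])%Z.
  case: (Bezoutz (x k) (q k)) => u [v uv]; exists u.
  by rewrite -(eqP (x_cop k)) -uv addrC mulrC modzMDl.
have u_coh k : (u k.+1 = u k %[mod q k])%Z.
  have uP1 : (u k.+1 * x k = 1 %[mod q k])%Z.
    by rewrite residue_coh modzMmr -(modz_pow _ _ (leqnSn k)) uP modz_pow.
  rewrite -[u k.+1]mulr1 -modzMmr -(uP k) modzMmr mulrCA -modzMmr uP1 modzMmr.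
  by rewrite mulr1.
apply/unitrP; exists (padic_mk p_pr u_coh).
have ux1 : padic_mk p_pr u_coh * x = 1.
  by apply: padic_eq => k; rewrite /= modzMml uP.
by rewrite [x * _]mulrC.
Qed.

Lemma padic_unit_natr n : ~~ (p %| n)%N -> (n%:R : Zp) \is a GRing.unit.
Proof.
by move=> pn; rewrite padic_unit_reduction // rmorph_nat -(dvdn_pcharf (pchar_Fp p_pr)).
Qed.

(** Completeness: the limit has the diagonal [u k k] as residues. *)
Lemma padic_limit (u : nat -> Zp) :
  (forall n, congr_mod (p%:R ^+ n) (u n.+1) (u n)) ->
  exists l, forall n, congr_mod (p%:R ^+ n) l (u n).
Proof.
move=> u_cvg; have l_coh k : u k k = (u k.+1 k.+1 %% q k)%Z.
  by rewrite -residue_coh; apply/esym/congr_mod_residueP.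
by exists (PadicInt p_pr l_coh) => n; apply/congr_mod_residueP.
Qed.

Lemma padic_separated (x y : Zp) :
  (forall n, congr_mod (p%:R ^+ n) x y) -> x = y.
Proof. by move=> xy; apply: padic_eq => n; apply/congr_mod_residueP. Qed.

Lemma padic_natr_neq0 : (p%:R : Zp) != 0.
Proof.
apply/eqP => /(congr1 (fun x : Zp => x 2)).
rewrite -[0]/(0%:R) !residue_natr mod0z modz_small; first by case: p p_pr.
by rewrite lez_nat ltz_nat leq0n -{1}(expn1 p) ltn_exp2l ?prime_gt1.
Qed.

End PadicIntegers.

(** * The quotient algebra *)

Section QuotientCongruences.
Variables (R : comNzRingType) (F : {poly R}).
Local Notation A := {poly %/ F}.

Lemma coef_qpoly_natM m (x : A) j :
  (m%:R * x : A)`_j = m%:R * (x : {poly R})`_j.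
Proof. by rewrite !mulr_natl raddfMn coefMn. Qed.

(** Multiplication by an integer acts coordinatewise; this reduces congruences, limits and
    separation in A to Z_p. *)
Lemma congr_mod_qpolyP m (x y : A) :
  congr_mod m%:R x y <->
  forall j, congr_mod m%:R ((x : {poly R})`_j) ((y : {poly R})`_j).
Proof.
split=> [[z xy] j|/choice[c cP]].
  exists (z : {poly R})`_j; rewrite -coef_qpoly_natM -xy raddfB /=.
  by rewrite coefB.
exists (mk_npoly _ c); apply/val_inj/polyP => j.
rewrite coef_qpoly_natM raddfB /= coefB coef_poly.
case: ltnP => [_|le_j]; first exact: cP.
by rewrite !big_coef_npoly // subrr mulr0.
Qed.

Lemma qpolyC_mull c (x : A) : qpolyC F c * x = c *: x.
Proof.
apply/val_inj; rewrite /= mul_polyC Pdiv.CommonRing.rmodp_small //.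
exact: size_mk_monic (c *: x : A).
Qed.

Lemma coef_horner_qpoly (g : {poly R}) (a : A) n l : (size g <= n)%N ->
  ((map_poly (qpolyC F) g).[a] : {poly R})`_l =
  \sum_(j < n) g`_j * (a ^+ j : {poly R})`_l.
Proof.
move=> g_n; rewrite (@horner_coef_wide _ n); last first.
  exact: leq_trans (size_poly _ _) g_n.
rewrite poly_of_qpoly_sum coef_sum; apply: eq_bigr => j _.
by rewrite coef_map qpolyC_mull coefZ.
Qed.

End QuotientCongruences.

Section CongrPoly.
Variable R : comNzRingType.

Lemma congr_mod_horner (m : R) (g : {poly R}) (a b : R) :
  congr_mod m a b -> congr_mod m g.[a] g.[b].
Proof.
move=> ab; rewrite !horner_coef; apply: congr_mod_sum => i.
by apply: congr_modM; [exact: congr_mod_refl | exact: congr_modX].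
Qed.

(** Over a ring that may have zero divisors, regular differences of roots are what allows dividing
    by X - r 0 and keeping the other roots on the quotient. *)
Lemma prod_XsubC_regular_roots n (f : {poly R}) (r : nat -> R) :
  f \is monic -> size f = n.+1 ->
  (forall i, (i < n)%N -> root f (r i)) ->
  (forall i j, (i < j < n)%N -> GRing.lreg (r j - r i)) ->
  f = \prod_(i < n) ('X - (r i)%:P).
Proof.
elim: n f r => [|n IHn] f r f_monic f_size f_root r_reg.
  rewrite big_ord0; have /size_poly1P[c _ fE] : size f == 1 by rewrite f_size.
  by move: f_monic; rewrite fE monicE lead_coefC => /eqP->.
have /factor_theorem[g fE] := f_root 0 isT.
have g_monic : g \is monic by rewrite -(monicMr g (monicXsubC (r 0))) -fE.
have g_size : size g = n.+1.
  move: f_size; rewrite fE size_Mmonic ?monic_neq0 ?monicXsubC //.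
  by rewrite size_XsubC addn2 => -[].
rewrite big_ord_recl fE mulrC; congr (_ * _).
apply: (IHn g (fun i => r i.+1)) => // [i lt_in|i j ij]; last first.
  exact: r_reg.
have := f_root i.+1 lt_in; rewrite /root fE hornerM !hornerE mulrC => /eqP r0.
have/r_reg reg: (0 < i.+1 < n.+1)%N by [].
by apply/eqP/reg; rewrite mulr0.
Qed.

End CongrPoly.

(** * The residue field and the conjugate product *)

Section Frobenius.
Variables (p : nat) (p_pr : prime p).

Lemma Fp_exp_pow (c : 'F_p) i : c ^+ (p ^ i) = c.
Proof.
have card_p : #|'F_p| = p by rewrite card_Fp.
elim: i => [|i IHi]; first by rewrite expn0 expr1.
by rewrite expnS mulnC exprM IHi -[in RHS](expf_card c) card_p.
Qed.

(** Frobenius is additive and fixes the coefficients in F_p. *)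
Lemma comp_poly_Xn_pow (h : {poly 'F_p}) i : h \Po 'X^(p ^ i) = h ^+ (p ^ i).
Proof.
have pcharP : p \in [pchar {poly 'F_p}] by rewrite pchar_poly pchar_Fp.
elim/poly_ind: h => [|h c IHh].
  by rewrite comp_poly0 expr0n expn_eq0 -leqn0 leqNgt prime_gt0.
rewrite comp_polyD comp_polyM comp_polyX comp_polyC IHh exprDn_pchar.
  by rewrite exprMn -polyC_exp Fp_exp_pow.
by rewrite (eq_pnat _ (pcharf_eq pcharP)) pnatX pnat_id.
Qed.

Lemma in_qpoly_eq0 (h P : {poly 'F_p}) :
  h \is monic -> (1 < size h)%N -> (in_qpoly h P == 0) = (h %| P).
Proof.
move=> h_monic h_gt1; rewrite -val_eqE /= Pdiv.Idomain.dvdpE.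
by rewrite /mk_monic h_gt1 h_monic.
Qed.

(* The elements of a finite field fixed by x |-> x ^ (p ^ m) are roots of      *)
(* 'X^(p ^ m) - 'X, so they fill a field of p ^ d elements only if d <= m.     *)
Lemma dvdp_Xn_pow_subX (h : {poly 'F_p}) d m :
  h \is monic -> irreducible_poly h -> size h = d.+1 -> (0 < m)%N ->
  h %| 'X^(p ^ m) - 'X -> (d <= m)%N.
Proof.
move=> h_monic h_irr h_size m_gt0 h_dvd.
pose hI : monic_irreducible_poly h := (h_irr, h_monic).
pose K : finFieldType := {poly %/ h with hI}.
have p_gt1 := prime_gt1 p_pr.
have pm_gt1 : (1 < p ^ m)%N by rewrite -(expn0 p) ltn_exp2l.
pose P : {poly K} := 'X^(p ^ m) - 'X.
have P_size : size P = (p ^ m).+1.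
  by rewrite size_polyDl size_polyXn // size_polyN size_polyX ltnS.
have X_pow : in_qpoly h 'X^(p ^ m) = in_qpoly h 'X.
  apply/eqP; rewrite -subr_eq0 -(rmorphB (in_qpoly h)) in_qpoly_eq0 //.
  by have [] := h_irr.
have pow_id (g : {poly 'F_p}) : in_qpoly h g ^+ (p ^ m) = in_qpoly h g.
  rewrite -[LHS](rmorphXn (in_qpoly h)) /= -comp_poly_Xn_pow in_qpoly_comp_horner.
  by rewrite X_pow -in_qpoly_comp_horner comp_polyXr.
have P_root : all (root P) (enum K).
  apply/allP => x _; rewrite /root !hornerE subr_eq0.
  have xE : in_qpoly h (x : {poly 'F_p}) = x.
    by apply/val_inj/in_qpoly_small; exact: size_mk_monic.
  by have /eqP := pow_id x; rewrite xE.
have := max_poly_roots _ P_root (enum_uniq K).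
rewrite -size_poly_eq0 P_size => /(_ isT); rewrite -cardE card_qfpoly h_size card_Fp //.
by rewrite ltnS leq_exp2l.
Qed.

End Frobenius.

(** * The Newton step *)

Lemma exprD1_mod_sqr (B : comNzRingType) (y : B) n :
  exists z, (1 + y) ^+ n = 1 + n%:R * y + y ^+ 2 * z.
Proof.
elim: n => [|n [z IHn]]; first by exists 0; rewrite expr0; ring.
by exists (n%:R + z + z * y); rewrite exprS IHn mulrS; ring.
Qed.

(* With e = a ^ s - 1, the Newton step multiplies a by 1 - t e (1 - e), where  *)
(* t = 1 / s.                                                                  *)
Lemma newton_step_expr (B : comNzRingType) (s : nat) (a t m : B) :
  s%:R * t = 1 -> congr_mod m (a ^+ s) 1 ->
  let b := a - t * ((a ^+ s - 1) * a * (2 - a ^+ s)) in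
  congr_mod (m ^+ 2) (b ^+ s) 1 /\ congr_mod m b a.
Proof.
move=> st1 [w]; set e := a ^+ s - 1 => ew b.
have asE : a ^+ s = 1 + e by rewrite /e addrC subrK.
have bE : b = a * (1 + - (t * e * (1 - e))) by rewrite /b asE; ring.
have [z zE] := exprD1_mod_sqr (- (t * e * (1 - e))) s.
have sE : s%:R * - (t * e * (1 - e)) = - (e * (1 - e)).
  by rewrite mulrN !mulrA st1 mul1r.
split; last by exists (- (t * w * (1 - e) * a)); rewrite bE ew; ring.
rewrite bE exprMn zE sE asE ew.
(* As (1 + e)(1 - e (1 - e)) = 1 + e^3, the error is e^3 plus 1 + e times the quadratic remainder;
   with e = m w both contain m^2. *)
exists (w ^+ 2 * (m * w + (1 + m * w) * (t * (1 - m * w)) ^+ 2 * z)); ring.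
Qed.

Lemma size_sub_monic (B : nzRingType) (f g : {poly B}) n :
  f \is monic -> g \is monic -> size f = n.+1 -> size g = n.+1 ->
  (size (f - g)%R < n.+1)%N.
Proof.
move=> /monicP f1 /monicP g1 f_size g_size; rewrite ltnS; apply/leq_sizeP => j.
rewrite leq_eqVlt coefB => /predU1P[<-|lt_nj].
  by move: f1 g1; rewrite /lead_coef f_size g_size => -> ->; rewrite subrr.
by rewrite !nth_default ?f_size ?g_size ?subrr.
Qed.

Definition newton_step (R : comUnitRingType) (F : {poly R}) (s : nat)
    (a : {poly %/ F}) : {poly %/ F} :=
  a - (s%:R : R)^-1 *: ((a ^+ s - 1) * a * (2 - a ^+ s)).

(** The iterates without any rounding: they define beta as their limit and are also what the program
    for alpha outputs. *)
Definition newton_iter (R : comUnitRingType) (F : {poly R}) (s k : nat) : {poly %/ F} :=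
  iter k (newton_step s) 'qX.

(** * Reduction to the residue field and cancellation in A *)

Section ConjugateProduct.
Variables (p : nat) (p_pr : prime p) (s : nat) (fbar : {poly 'F_p}) (d : nat).
Variable F : {poly padic_int p_pr}.
Hypotheses (s_gt0 : (0 < s)%N) (p_ndvd_s : ~~ (p %| s)%N).
Hypotheses (fbar_monic : fbar \is monic) (fbar_irr : irreducible_poly fbar).
Hypothesis fbar_Phi : fbar %| map_poly intr 'Phi_s.
Hypothesis fbar_size : size fbar = d.+1.
Hypotheses (F_monic : F \is monic) (F_red : map_poly (@reduction p p_pr) F = fbar).

Local Notation Zp := (padic_int p_pr).
Local Notation A := {poly %/ F}.
Local Notation red := (map_poly (@reduction p p_pr)).
Local Notation ev g a := (map_poly (qpolyC F) g).[a].
Let hI : monic_irreducible_poly fbar := (fbar_irr, fbar_monic).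
Local Notation K := {poly %/ fbar with hI}.

Lemma degree_gt0 : (0 < d)%N.
Proof. by have [] := fbar_irr; rewrite fbar_size. Qed.

Lemma size_lift : size F = d.+1.
Proof.
rewrite -fbar_size -F_red size_map_poly_id0 //.
by rewrite (monicP F_monic) rmorph1 oner_neq0.
Qed.

Lemma mk_monic_lift : mk_monic F = F.
Proof. by rewrite /mk_monic size_lift ltnS degree_gt0 F_monic. Qed.

Lemma mk_monic_fbar : mk_monic fbar = fbar.
Proof. by rewrite /mk_monic fbar_size ltnS degree_gt0 fbar_monic. Qed.

Lemma size_quotient (x : A) : (size (x : {poly Zp}) <= d)%N.
Proof. by rewrite -ltnS -size_lift -{2}mk_monic_lift size_mk_monic. Qed.

Definition residue_class (x : A) : K := in_qpoly fbar (red x).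

(** Well-definedness of the reduction map: F reduces to fbar, which vanishes in K. *)
Lemma residue_class_in_qpoly P : residue_class (in_qpoly F P) = in_qpoly fbar (red P).
Proof.
rewrite /residue_class /= mk_monic_lift.
rewrite [in RHS](Pdiv.RingMonic.rdivp_eq F_monic P) rmorphD rmorphM /= F_red.
rewrite (rmorphD (in_qpoly fbar)) (rmorphM (in_qpoly fbar)) /=.
have /eqP -> : in_qpoly fbar fbar == 0.
  by rewrite in_qpoly_eq0 ?fbar_size ?ltnS ?degree_gt0.
by rewrite mulr0 add0r.
Qed.

Fact residue_class_zmod_morphism : zmod_morphism residue_class.
Proof. by move=> x y; rewrite /residue_class !raddfB. Qed.

Fact residue_class_monoid_morphism : monoid_morphism residue_class.
Proof.
split=> [|x y].
  by rewrite -(rmorph1 (in_qpoly F)) residue_class_in_qpoly !rmorph1.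
by rewrite residue_class_in_qpoly rmorphM /= (rmorphM (in_qpoly fbar)).
Qed.

HB.instance Definition _ :=
  GRing.isZmodMorphism.Build A K residue_class residue_class_zmod_morphism.
HB.instance Definition _ :=
  GRing.isMonoidMorphism.Build A K residue_class residue_class_monoid_morphism.

(** Representatives in A have degree below d = deg fbar, so no further division takes place and
    equality in K is coefficientwise. *)
Lemma residue_class_eqP (x y : A) :
  residue_class x = residue_class y <-> congr_mod p%:R x y.
Proof.
have val_class (z : A) : residue_class z = red z :> {poly 'F_p}.
  apply: in_qpoly_small; rewrite mk_monic_fbar fbar_size ltnS.
  exact: leq_trans (size_poly _ _) (size_quotient z).
rewrite congr_mod_qpolyP; split=> [xy j|xy].
  by apply/reduction_eqP; rewrite -!coef_map -!val_class xy.
congr in_qpoly; apply/polyP => j; rewrite !coef_map /=; exact/reduction_eqP.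
Qed.

Lemma residue_class_eq0P (x : A) :
  residue_class x = 0 <-> congr_mod p%:R x 0.
Proof. by rewrite -residue_class_eqP rmorph0. Qed.

Lemma quotient_natr_inj : injective (fun x : A => p%:R * x).
Proof.
move=> x y /= /(congr1 (fun z : A => (z : {poly Zp}))) xy.
apply/val_inj/polyP => j; apply: (mulfI (padic_natr_neq0 p_pr)).
by rewrite -!coef_qpoly_natM xy.
Qed.

Lemma quotient_separated (x y : A) :
  (forall n, congr_mod (p%:R ^+ n) x y) -> x = y.
Proof.
move=> xy; apply/val_inj/polyP => j; apply: padic_separated => n.
by rewrite -natrX; move: j; apply/congr_mod_qpolyP; rewrite natrX.
Qed.

(** Induction on m: once x = p^m y, cancelling p^m leaves u y in p A, and y is in p A because K is a
    field. *)
Lemma congr_mod_mulI m (u x : A) : residue_class u != 0 ->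
  congr_mod (p%:R ^+ m) (u * x) 0 -> congr_mod (p%:R ^+ m) x 0.
Proof.
move=> u_neq0; elim: m => [|m IHm] ux0; first by exists x; rewrite subr0 mul1r.
have [|y] := IHm; first exact: congr_modXl ux0.
rewrite subr0 => xE; have [z] := ux0; rewrite subr0 xE exprSr mulrCA -mulrA => uy.
have uy_eq : u * y = p%:R * z.
  elim: (m) uy => [|k IHk]; first by rewrite !mul1r.
  by rewrite exprS -!mulrA => /quotient_natr_inj.
have [] : congr_mod p%:R y 0.
  apply/residue_class_eq0P/eqP; have /eqP : residue_class (u * y) = 0.
    by rewrite uy_eq; apply/residue_class_eq0P; exists z; rewrite subr0.
  by rewrite rmorphM mulf_eq0 (negPf u_neq0).
by move=> w; rewrite subr0 => yE; exists w; rewrite subr0 yE mulrA.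
Qed.

Lemma quotient_mulI (u : A) : residue_class u != 0 -> GRing.lreg u.
Proof.
move=> u_neq0 x y /eqP; rewrite -subr_eq0 -mulrBr => /eqP uxy.
apply: quotient_separated => n; apply/congr_mod_subr0.
by apply: (congr_mod_mulI u_neq0); rewrite uxy; apply: congr_mod_refl.
Qed.

(** In K the value is gbar(X^(p^i)), which is gbar(X)^(p^i) by Frobenius. *)
Lemma residue_class_ev (g : {poly Zp}) (a : A) i : congr_mod p%:R a 'qX ->
  residue_class (ev g (a ^+ (p ^ i))) = in_qpoly fbar (red g) ^+ (p ^ i).
Proof.
move=> aX; have /residue_class_eqP -> :
    congr_mod p%:R (ev g (a ^+ (p ^ i))) (ev g (in_qpoly F 'X^(p ^ i))).
  apply: congr_mod_horner; rewrite (rmorphXn (in_qpoly F)).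
  exact: congr_modX.
rewrite -in_qpoly_comp_horner residue_class_in_qpoly map_comp_poly map_polyXn.
by rewrite comp_poly_Xn_pow // -[RHS](rmorphXn (in_qpoly fbar)).
Qed.

Lemma residue_class_ev_neq0 (g : {poly Zp}) (a : A) i :
  congr_mod p%:R a 'qX -> ~~ (fbar %| red g) ->
  residue_class (ev g (a ^+ (p ^ i))) != 0.
Proof.
move=> aX g_ndvd; rewrite residue_class_ev // expf_neq0 //.
by rewrite in_qpoly_eq0 ?fbar_size ?ltnS ?degree_gt0.
Qed.

(** * Roots of factors of X^s - 1 *)

Lemma Cyclotomic_cofactor :
  exists Psi : {poly Zp}, 'X^s - 1 = map_poly intr 'Phi_s * Psi.
Proof.
pose r := rem s (divisors s).
exists (map_poly intr (\prod_(e <- r) 'Phi_e)).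
have s_div : s \in divisors s by rewrite -dvdn_divisors.
rewrite -rmorphM /= -(big_rem _ s_div (P := predT)) /= prod_Cyclotomic //.
by rewrite rmorphB /= map_polyXn rmorph1.
Qed.

Lemma red_Cyclotomic : fbar %| red (map_poly intr 'Phi_s).
Proof.
by rewrite -map_poly_comp (eq_map_poly (g := intr)) // => z; rewrite /= rmorph_int.
Qed.

(** X^s - 1 is separable modulo p, so its two reduced factors are coprime. *)
Lemma separable_cofactor (P Q : {poly Zp}) :
  'X^s - 1 = P * Q -> fbar %| red P -> ~~ (fbar %| red Q).
Proof.
move=> PQ fbP; apply/negP => fbQ.
have : separable_poly ('X^s - 1 : {poly 'F_p}).
  by apply: separable_Xn_sub_1; rewrite -(dvdn_pcharf (pchar_Fp p_pr)).
have -> : 'X^s - 1 = red P * red Q :> {poly 'F_p}.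
  by rewrite -rmorphM /= -PQ rmorphB /= map_polyXn rmorph1.
rewrite separable_mul => /and3P[_ _ /coprimepP/(_ _ fbP fbQ)].
by rewrite -size_poly_eq1 fbar_size eqSS eqn0Ngt degree_gt0.
Qed.

(** With b = a^(p^i), P(b) Q(b) = b^s - 1 = 0, and Q(b) has nonzero class, hence cancels. *)
Lemma ev_root_pow (P Q : {poly Zp}) (a : A) i :
  'X^s - 1 = P * Q -> fbar %| red P -> congr_mod p%:R a 'qX -> a ^+ s = 1 ->
  ev P (a ^+ (p ^ i)) = 0.
Proof.
move=> PQ fbP aX as1; have fbQ := separable_cofactor PQ fbP.
apply: (quotient_mulI (residue_class_ev_neq0 i aX fbQ)).
rewrite mulr0 mulrC -hornerM -rmorphM /= -PQ rmorphB /= map_polyXn rmorph1.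
by rewrite !hornerE exprAC as1 expr1n subrr.
Qed.

(** * Powers of an element congruent to X as a basis of A *)

Definition power_mx (a : A) : 'M[Zp]_d :=
  \matrix_(j, l) (a ^+ j : {poly Zp})`_l.

Lemma power_mx_congr (a : A) (j l : nat) :
  congr_mod p%:R a 'qX -> (j < d)%N ->
  congr_mod p%:R ((a ^+ j : {poly Zp})`_l) (l == j)%:R.
Proof.
move=> aX lt_jd; have : congr_mod p%:R (a ^+ j) (in_qpoly F 'X^j).
  by rewrite (rmorphXn (in_qpoly F)); apply: congr_modX.
move/congr_mod_qpolyP/(_ l); rewrite in_qpoly_small ?coefXn //.
by rewrite mk_monic_lift size_lift size_polyXn ltnS.
Qed.

(** The matrix reduces to the identity, so its determinant reduces to 1 and is a unit of Z_p. *)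
Lemma power_mx_unit (a : A) : congr_mod p%:R a 'qX -> power_mx a \in unitmx.
Proof.
move=> aX; rewrite unitmxE padic_unit_reduction // -det_map_mx.
suff -> : map_mx (@reduction p p_pr) (power_mx a) = 1%:M.
  by rewrite det1 oner_neq0.
apply/matrixP => j l; rewrite !mxE -(rmorph_nat (@reduction p p_pr)).
by apply/reduction_eqP; rewrite eq_sym; apply: power_mx_congr.
Qed.

Lemma ev_power_mx (a : A) (g : {poly Zp}) : (size g <= d)%N ->
  poly_rV (ev g a) = poly_rV g *m power_mx a :> 'rV_d.
Proof.
move=> g_d; apply/rowP => l; rewrite !mxE (coef_horner_qpoly _ _ g_d).
by apply: eq_bigr => j _; rewrite !mxE.
Qed.

Lemma ev_surj (a b : A) : congr_mod p%:R a 'qX ->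
  exists2 g : {poly Zp}, (size g <= d)%N & ev g a = b.
Proof.
move=> /power_mx_unit aU; pose c : 'rV_d := poly_rV b *m invmx (power_mx a).
exists (rVpoly c); first exact: size_poly.
apply/val_inj; rewrite -[LHS](@poly_rV_K _ d) ?size_quotient //.
by rewrite ev_power_mx ?size_poly // rVpolyK mulmxKV // poly_rV_K ?size_quotient.
Qed.

(** The coefficients of g are recovered from the coordinates of g(a) by the inverse matrix over Z_p,
    which preserves divisibility by p^m. *)
Lemma ev_congr_mod (a : A) (g : {poly Zp}) m :
  congr_mod p%:R a 'qX -> (size g <= d)%N ->
  congr_mod (p%:R ^+ m) (ev g a) 0 -> congr_mod (p%:R ^+ m) g 0.
Proof.
move=> /power_mx_unit aU g_d [z]; rewrite subr0 => gz.
exists (rVpoly (poly_rV z *m invmx (power_mx a) : 'rV_d)).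
rewrite subr0 -[LHS](@poly_rV_K _ d) // -[poly_rV g](mulmxK aU).
rewrite -ev_power_mx // gz.
have -> : poly_rV (p%:R ^+ m * z : A) = (p%:R ^+ m) *: poly_rV z :> 'rV_d.
  by apply/rowP => l; rewrite !mxE -natrX coef_qpoly_natM natrX.
by rewrite -scalemxAl linearZ /= -mul_polyC rmorphXn rmorph_nat.
Qed.

Lemma ev_inj (a : A) (g : {poly Zp}) :
  congr_mod p%:R a 'qX -> (size g <= d)%N -> ev g a = 0 -> g = 0.
Proof.
move=> aX g_d ga0; apply/polyP => j; apply: padic_separated => m; rewrite coef0.
have [|z] := @ev_congr_mod a g m aX g_d.
  by rewrite ga0; apply: congr_mod_refl.
rewrite subr0 => ->; exists z`_j.
by rewrite subr0 -natrX mulr_natl coefMn -natrX mulr_natl.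
Qed.

Lemma minimal_relation (a : A) : congr_mod p%:R a 'qX ->
  exists g : {poly Zp}, [/\ g \is monic, size g = d.+1 & ev g a = 0].
Proof.
move=> aX; have [h h_d ha] := ev_surj (a ^+ d) aX.
exists ('X^d - h); have lt_hd : (size (- h) < size ('X^d : {poly Zp}))%N.
  by rewrite size_polyXn size_polyN ltnS.
rewrite monicE lead_coefDl // lead_coefXn eqxx size_polyDl // size_polyXn.
by rewrite rmorphB /= map_polyXn !hornerE ha subrr.
Qed.

(** * Convergence of the Newton iteration *)

Lemma natr_s_unit : (s%:R : Zp) \is a GRing.unit.
Proof. exact: padic_unit_natr. Qed.

Lemma natr_s_inv : (s%:R : A) * (s%:R : Zp)^-1%:A = 1.
Proof.
by rewrite -(scaler_nat s (1 : A)) -scalerAl mul1r scalerA mulrV ?natr_s_unit // scale1r.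
Qed.

Lemma newton_step_congr (m a : A) : congr_mod m (a ^+ s) 1 ->
  congr_mod (m ^+ 2) (newton_step s a ^+ s) 1 /\ congr_mod m (newton_step s a) a.
Proof.
move=> as1; rewrite /newton_step -[_ *: _]mulr_algl.
exact: newton_step_expr natr_s_inv as1.
Qed.

Lemma residue_class_X_pow : residue_class 'qX ^+ s = 1.
Proof.
have [Psi Xs] := Cyclotomic_cofactor.
rewrite residue_class_in_qpoly map_polyX -[LHS](rmorphXn (in_qpoly fbar)) /=.
apply/eqP; rewrite -subr_eq0 -(rmorph1 (in_qpoly fbar)) -(rmorphB (in_qpoly fbar)).
rewrite in_qpoly_eq0 ?fbar_size ?ltnS ?degree_gt0 //.
have -> : 'X^s - 1 = red ('X^s - 1) by rewrite rmorphB /= map_polyXn rmorph1.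
by rewrite Xs rmorphM dvdp_mulr // red_Cyclotomic.
Qed.

(** The start holds since X^s = 1 in K and 2^0 = 1; rounding modulo p^(2^i) respects both
    congruences. *)
Lemma newton_seq_congr n (alpha : nat -> A) : newton_seq s n alpha ->
  forall i, (i <= n)%N ->
  congr_mod (p%:R ^+ (2 ^ i)) (alpha i ^+ s) 1 /\ congr_mod p%:R (alpha i) 'qX.
Proof.
case=> alpha0 alphaS; elim=> [_|i IHi lt_in].
  rewrite expn0 expr1 alpha0; split; last exact: congr_mod_refl.
  by apply/residue_class_eqP; rewrite rmorph1 rmorphXn residue_class_X_pow.
have [as1 aX] := IHi (ltnW lt_in).
have [bs1 ba] := newton_step_congr as1.
have /= ab := alphaS i.+1 lt_in; split.
  by apply: congr_mod_trans (congr_modX _ ab) _; rewrite expnS mulnC exprM.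
apply: congr_mod_trans aX; apply: (@congr_mod_trans _ _ _ (newton_step s (alpha i))).
  by rewrite -[p%:R]expr1; apply: congr_modXl ab; rewrite expn_gt0.
by rewrite -[p%:R]expr1; apply: congr_modXl ba; rewrite expn_gt0.
Qed.

Lemma newton_iter_seq n : newton_seq s n (newton_iter F s).
Proof. by split=> // -[|i] // _; apply: congr_mod_refl. Qed.

(** Consecutive exact iterates agree modulo p^(2^i), hence modulo p^i, so each coordinate converges
    in Z_p. *)
Lemma newton_root : exists beta : A, beta ^+ s = 1 /\ congr_mod p%:R beta 'qX.
Proof.
have iterP i := newton_seq_congr (newton_iter_seq i) (leqnn i).
have iter_cvg i j : congr_mod (p%:R ^+ i)
    ((newton_iter F s i.+1 : {poly Zp})`_j) ((newton_iter F s i : {poly Zp})`_j).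
  rewrite -natrX; move: j; apply/congr_mod_qpolyP; rewrite natrX.
  have [_ ba] := newton_step_congr (iterP i).1.
  by apply: congr_modXl ba; rewrite ltnW // ltn_expl.
have /choice[c cP] j := padic_limit (iter_cvg^~ j).
pose beta : A := mk_npoly _ c.
have betaP i : congr_mod (p%:R ^+ i) beta (newton_iter F s i).
  rewrite -natrX; apply/congr_mod_qpolyP => j; rewrite natrX coef_poly.
  case: ltnP => [_|le_j]; first exact: cP.
  by rewrite big_coef_npoly //; apply: congr_mod_refl.
exists beta; split.
  apply: quotient_separated => i; apply: congr_mod_trans (congr_modX _ (betaP i)) _.
  by apply: congr_modXl (iterP i).1; rewrite ltnW // ltn_expl.
apply: congr_mod_trans (iterP 1).2; rewrite -[p%:R]expr1; exact: betaP.
Qed.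

(** The cofactor of a - b in a^s - b^s has class s X^(s-1), which is nonzero because s is invertible
    and X^s = 1 in K. *)
Lemma unity_root_congr (a b : A) m :
  congr_mod p%:R a 'qX -> congr_mod p%:R b 'qX ->
  congr_mod (p%:R ^+ m) (a ^+ s) (b ^+ s) -> congr_mod (p%:R ^+ m) a b.
Proof.
move=> /residue_class_eqP aX /residue_class_eqP bX /congr_mod_subr0.
rewrite subrXX mulrC => ab; apply/congr_mod_subr0; apply: congr_mod_mulI ab.
rewrite rmorph_sum (eq_bigr (fun=> residue_class 'qX ^+ s.-1)) => [|i _]; last first.
  rewrite rmorphM !rmorphXn /= aX bX -exprD; congr (_ ^+ _).
  by have := ltn_ord i; lia.
rewrite sumr_const card_ord -mulr_natl mulf_neq0 //.
  apply: contraTneq isT => s0; have := congr1 residue_class natr_s_inv.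
  by rewrite rmorphM rmorph_nat s0 mul0r rmorph1 => /esym/eqP; rewrite oner_eq0.
rewrite expf_neq0 //; apply: contraTneq isT => X0; have := residue_class_X_pow.
by rewrite X0 expr0n gtn_eqF // => /esym/eqP; rewrite oner_eq0.
Qed.

(** * The conjugate product *)

Lemma conj_prod_root (f : {poly Zp}) (beta : A) :
  f \is monic -> size f = d.+1 -> congr_mod p%:R beta 'qX ->
  (forall i, ev f (beta ^+ (p ^ i)) = 0) ->
  map_poly (qpolyC F) f = conj_prod d beta.
Proof.
move=> f_monic f_size betaX f_root.
apply: (prod_XsubC_regular_roots (r := fun i => beta ^+ (p ^ i))).
- exact: monic_map.
- by rewrite size_map_poly_id0 // (monicP f_monic) oner_neq0.
- by move=> i _; apply/eqP; apply: f_root.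
move=> i j /andP[lt_ij lt_jd]; apply: quotient_mulI; rewrite rmorphB !rmorphXn /=.
have /residue_class_eqP -> := betaX.
have X_pow k : residue_class 'qX ^+ k = in_qpoly fbar 'X^k :> K.
  by rewrite residue_class_in_qpoly map_polyX -[LHS](rmorphXn (in_qpoly fbar)).
have fbar_gt1 : (1 < size fbar)%N by rewrite fbar_size ltnS degree_gt0.
rewrite !X_pow -(rmorphB (in_qpoly fbar)) in_qpoly_eq0 //; apply/negP => fbX.
(* If X^(p^i) = X^(p^j) in K, injectivity of Frobenius brings this down to X^(p^(j-i)) = X, which
   forces d <= j - i. *)
have : in_qpoly fbar ('X^(p ^ (j - i)) - 'X) == 0 :> K.
  suff : (in_qpoly fbar ('X^(p ^ (j - i)) - 'X) : K) ^+ (p ^ i) == 0.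
    by rewrite expf_eq0 => /andP[].
  rewrite -[X in X == _](rmorphXn (in_qpoly fbar)) /= in_qpoly_eq0 //.
  rewrite -comp_poly_Xn_pow // comp_polyB comp_polyX comp_Xn_poly -exprM -expnD.
  by rewrite subnKC // ltnW.
rewrite in_qpoly_eq0 // => /(dvdp_Xn_pow_subX p_pr fbar_monic fbar_irr fbar_size).
by rewrite subn_gt0 => /(_ lt_ij); lia.
Qed.

(** The last clause, on any monic relation G of degree d, is what allows the product to be expanded
    by linear algebra. *)
Lemma conj_prod_congr_lift : exists ft : {poly Zp},
  unique (cyclotomic_lift s fbar) ft /\
  forall n (alpha : nat -> A), newton_seq s n alpha ->
    congr_mod (p%:R ^+ (2 ^ n)) (conj_prod d (alpha n)) (map_poly (qpolyC F) ft) /\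
    forall G : {poly Zp}, G \is monic -> size G = d.+1 -> ev G (alpha n) = 0 ->
      congr_mod (p%:R ^+ (2 ^ n)) (map_poly (qpolyC F) G) (conj_prod d (alpha n)).
Proof.
have [beta [beta_s betaX]] := newton_root.
have [f [f_monic f_size f_beta]] := minimal_relation betaX.
have [Psi XsPhi] := Cyclotomic_cofactor.
have fbar_f : red f = fbar.
  have fbar_dvd : fbar %| red f.
    rewrite -in_qpoly_eq0 ?fbar_size ?ltnS ?degree_gt0 //.
    have := residue_class_ev f 0 betaX; rewrite expn0 !expr1 f_beta rmorph0.
    by move=> <-.
  have f_size' : size (red f) = d.+1.
    by rewrite size_map_poly_id0 // (monicP f_monic) rmorph1 oner_neq0.
  apply/esym/eqP; rewrite -eqp_monic ?monic_map // -dvdp_size_eqp //.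
  by rewrite f_size' fbar_size.
have Phi_beta : ev (map_poly intr 'Phi_s) beta = 0.
  rewrite -[beta]expr1 -(expn0 p).
  by apply: (ev_root_pow _ XsPhi) => //; rewrite red_Cyclotomic.
(* The remainder of Phi_s by f has degree below d and kills beta, so it is 0. *)
have [g PhiE] : exists g, map_poly intr 'Phi_s = f * g.
  have := Pdiv.RingMonic.rdivp_eq f_monic (map_poly intr 'Phi_s).
  set r := Pdiv.Ring.rmodp _ _ => PhiE.
  suff r0 : r = 0.
    exists (Pdiv.Ring.rdivp (map_poly intr 'Phi_s) f).
    by rewrite [LHS]PhiE r0 addr0 mulrC.
  apply: (ev_inj betaX); first rewrite -ltnS -f_size.
    by rewrite Pdiv.CommonRing.ltn_rmodpN0 ?monic_neq0.
  have := Phi_beta; rewrite PhiE rmorphD rmorphM !hornerE.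
  by rewrite f_beta mulr0 add0r.
have XsE : 'X^s - 1 = f * (g * Psi) by rewrite mulrA -PhiE.
have conjE : map_poly (qpolyC F) f = conj_prod d beta.
  apply: conj_prod_root => // i.
  by apply: (ev_root_pow _ XsE) => //; rewrite fbar_f.
exists f; split.
  split; first by split=> //; exists g.
  (* Another lift f' also kills beta, and f - f' has degree below d. *)
  move=> f' [f'_monic [g' PhiE'] f'_red].
  have f'_size : size f' = d.+1.
    rewrite -fbar_size -f'_red size_map_poly_id0 //.
    by rewrite (monicP f'_monic) rmorph1 oner_neq0.
  apply/eqP; rewrite eq_sym -subr_eq0; apply/eqP/(ev_inj betaX).
    by rewrite -ltnS; apply: size_sub_monic.
  have f'_beta : ev f' (beta ^+ (p ^ 0)) = 0.
    apply: (@ev_root_pow f' (g' * Psi)) => //; last by rewrite f'_red.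
    by rewrite mulrA -PhiE'.
  by rewrite rmorphB !hornerE f_beta -[beta]expr1 -(expn0 p) f'_beta subrr.
move=> n alpha alphaP; have [as1 aX] := newton_seq_congr alphaP (leqnn n).
have ab : congr_mod (p%:R ^+ (2 ^ n)) (alpha n) beta.
  by apply: unity_root_congr => //; rewrite beta_s.
have prodE : congr_mod (p%:R ^+ (2 ^ n)) (conj_prod d (alpha n)) (map_poly (qpolyC F) f).
  rewrite conjE; apply: congr_mod_prod => i.
  apply: congr_modB; first exact: congr_mod_refl.
  rewrite -(rmorph_nat (@polyC _)) -rmorphXn.
  by apply: congr_mod_map; apply: congr_modX.
split=> // G G_monic G_size G_alpha.
apply: congr_mod_trans (congr_mod_sym prodE).
(* G - f has degree below d, and its value at alpha is -f(alpha), congruent to -f(beta) = 0. *)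
have : congr_mod (p%:R ^+ (2 ^ n)) G f.
  apply/congr_mod_subr0/(ev_congr_mod aX); first by rewrite -ltnS; apply: size_sub_monic.
  rewrite rmorphB !hornerE G_alpha sub0r -oppr0; apply: congr_modN.
  by rewrite -f_beta; apply: congr_mod_horner.
move/(congr_mod_map (map_poly (qpolyC F))).
by rewrite rmorphXn rmorph_nat.
Qed.

End ConjugateProduct.

(** * Straight-line computability *)

Section Computability.
Local Open Scope classical_set_scope.
Variables (R : idomainType) (I : Type).
Local Notation V := (I -> R).
Local Notation K := {fraction R}.
Implicit Types (L : seq V) (S T U : set V) (x y v : V).

(** Cells are functions of an environment [i] ranging over the admissible inputs, so that one code
    serves all of them. *)
Definition mem_at L (i : I) : seq K := [seq FracField.tofrac (v i) | v <- L].

Definition stores L : set V := [set v | exists k, onth L k = Some v].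

(* N operations, chosen uniformly in the environment i : I, extend any memory  *)
(* that stores the values of S to one that also stores those of T.             *)
Definition computable (N : nat) S T : Prop := forall L, S `<=` stores L ->
  exists c ext, [/\ (size c <= N)%N,
    forall i, exec (mem_at L i) c = Some (mem_at (L ++ ext) i)
    & T `<=` stores (L ++ ext)].

Lemma stores_catl L L' : stores L `<=` stores (L ++ L').
Proof.
move=> v [k kv]; exists k; rewrite onth_cat; case: ltnP => // le_k.
by rewrite onth_default in kv.
Qed.

Lemma stores_rcons L v : stores (rcons L v) v.
Proof. by exists (size L); rewrite -cats1 onth_cat ltnn subnn. Qed.

Lemma exec_cat (F : fieldType) (m : seq F) c1 c2 :
  exec m (c1 ++ c2) = if exec m c1 is Some m' then exec m' c2 else None.
Proof. by elim: c1 m => //= c c1 IHc m; case: exec_instr. Qed.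

Lemma computable_sub S T : T `<=` S -> computable 0 S T.
Proof.
move=> TS L SL; by exists [::], [::]; rewrite cats0; split=> // v /TS /SL.
Qed.

Lemma computable_weaken N M S S' T T' : (N <= M)%N -> S `<=` S' -> T' `<=` T ->
  computable N S T -> computable M S' T'.
Proof.
move=> NM SS' T'T cST L S'L; have [c [ext [cN cE TL]]] := cST L (subset_trans SS' S'L).
exists c, ext; split=> //; [exact: leq_trans NM | exact: subset_trans TL].
Qed.

Lemma computable_leq N M S T : (N <= M)%N -> computable N S T -> computable M S T.
Proof. by move=> NM; apply: computable_weaken. Qed.

Lemma computable_trans N M S T U : computable N S T ->
  computable M (S `|` T) U -> computable (N + M) S (T `|` U).
Proof.
move=> cST cTU L SL; have [c [ext [cN cE TL]]] := cST L SL.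
have [|c' [ext' [cM cE' UL]]] := cTU (L ++ ext).
  by move=> v [/SL|/TL] // ?; apply: stores_catl.
exists (c ++ c'), (ext ++ ext'); rewrite size_cat leq_add //; split=> // [i|v].
  by rewrite exec_cat cE cE' catA.
by rewrite catA => -[/TL|/UL] // ?; apply: stores_catl.
Qed.

Lemma computable_bind N M S T U : computable N S T ->
  computable M (S `|` T) U -> computable (N + M) S U.
Proof.
move=> cST cTU; apply: computable_weaken (computable_trans cST cTU) => //.
Qed.

Lemma computable_bigcup n N S (T : nat -> set V) :
  (forall k, (k < n)%N -> computable N S (T k)) ->
  computable (n * N) S [set v | exists2 k, (k < n)%N & T k v].
Proof.
elim: n => [|n IHn] cT; first by apply: computable_sub => v [].
have cn : computable N (S `|` [set v | exists2 k, (k < n)%N & T k v]) (T n).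
  by apply: computable_weaken (cT n _) => //; apply: subsetUl.
have := computable_trans (IHn (fun k lt_kn => cT k (ltnW lt_kn))) cn.
apply: computable_weaken => //; first by rewrite mulSn addnC.
move=> v [k]; rewrite ltnS leq_eqVlt => /predU1P[-> Tv|lt_kn Tv]; first by right.
by left; exists k.
Qed.

Lemma computable_iter n N S (T : nat -> set V) :
  (forall k, (k < n)%N -> computable N (S `|` T k) (T k.+1)) ->
  computable (n * N) (S `|` T 0) [set v | exists2 k, (k <= n)%N & T k v].
Proof.
elim: n => [|n IHn] cT.
  by apply: computable_sub => v [k]; rewrite leqn0 => /eqP->; right.
have cn : computable N ((S `|` T 0) `|` [set v | exists2 k, (k <= n)%N & T k v]) (T n.+1).
  apply: computable_weaken (cT n _) => // v [Sv|Tv]; first by left; left.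
  by right; exists n.
have := computable_trans (IHn (fun k lt_kn => cT k (ltnW lt_kn))) cn.
apply: computable_weaken => //; first by rewrite mulSn addnC.
move=> v [k]; rewrite leq_eqVlt => /predU1P[-> Tv|lt_kn Tv]; first by right.
by left; exists k.
Qed.

Lemma onth_mem_at L k v i : onth L k = Some v ->
  onth (mem_at L i) k = Some (FracField.tofrac (v i)).
Proof. by move=> kv; rewrite onth_map kv. Qed.

Lemma computable_step S v :
  (forall L, S `<=` stores L -> exists c : instr, forall i,
     exec_instr (mem_at L i) c = Some (FracField.tofrac (v i))) ->
  computable 1 S [set v].
Proof.
move=> cv L /cv[c cE]; exists [:: c], [:: v]; split=> // [i|_ ->].
  by rewrite /= cE cats1 /mem_at map_rcons.
by rewrite cats1; apply: stores_rcons.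
Qed.

Lemma computable_one S : computable 1 S [set fun=> 1].
Proof.
by apply: computable_step => L SL; exists Defs.IOne => i; rewrite /= rmorph1.
Qed.

Lemma computable_op2 N M S x y v (c : nat -> nat -> instr) :
  (forall i (m : seq K) k l, onth m k = Some (FracField.tofrac (x i)) ->
     onth m l = Some (FracField.tofrac (y i)) ->
     exec_instr m (c k l) = Some (FracField.tofrac (v i))) ->
  computable N S [set x] -> computable M S [set y] ->
  computable (N + M).+1 S [set v].
Proof.
move=> cE cx cy; rewrite -addn1 -addnA; apply: computable_bind cx _.
have cy' : computable M (S `|` [set x]) [set y] by apply: computable_weaken cy.
apply: computable_bind cy' _.
apply: computable_step => L SL.
have [|k xk] := SL x; first by left; right.
have [|l yl] := SL y; first by right.
by exists (c k l) => i; apply: (cE i); apply: onth_mem_at.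
Qed.

Lemma computable_add N M S x y : computable N S [set x] ->
  computable M S [set y] -> computable (N + M).+1 S [set fun i => x i + y i].
Proof.
by apply: (@computable_op2 _ _ _ _ _ _ IAdd) => i m k l /= -> ->; rewrite rmorphD.
Qed.

Lemma computable_sub2 N M S x y : computable N S [set x] ->
  computable M S [set y] -> computable (N + M).+1 S [set fun i => x i - y i].
Proof.
by apply: (@computable_op2 _ _ _ _ _ _ ISub) => i m k l /= -> ->; rewrite rmorphB.
Qed.

Lemma computable_mul N M S x y : computable N S [set x] ->
  computable M S [set y] -> computable (N + M).+1 S [set fun i => x i * y i].
Proof.
by apply: (@computable_op2 _ _ _ _ _ _ IMul) => i m k l /= -> ->; rewrite rmorphM.
Qed.

(** Symbolic values lie in R; dividing by units of R keeps them there and never fails. *)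
Lemma computable_div N M S x y : (forall i, y i \is a GRing.unit) ->
  computable N S [set x] -> computable M S [set y] ->
  computable (N + M).+1 S [set fun i => x i / y i].
Proof.
move=> yU; apply: (@computable_op2 _ _ _ _ _ _ IDiv) => i m k l /= -> ->.
have y_neq0 : y i != 0 by apply: contraTneq (yU i) => ->; rewrite unitr0.
by rewrite tofrac_eq0 (negPf y_neq0) rmorphM rmorphV.
Qed.

Lemma computable_mem S v : S v -> computable 0 S [set v].
Proof. by move=> Sv; apply: computable_sub => _ ->. Qed.

(** The output addresses are positions in the symbolic memory, hence the same in every
    environment. *)
Lemma computable_slp N S T (inp outp : seq V) :
  S `<=` stores inp -> stores outp `<=` T -> computable N S T ->
  exists P : slp, (cost P <= N)%N /\
    forall i, computes P (mem_at inp i) (mem_at outp i).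
Proof.
move=> Sinp outT /(_ _ Sinp)[c [ext [cN cE TL]]].
have [addr addrE] : exists addr,
    [seq onth (inp ++ ext) k | k <- addr] = [seq Some v | v <- outp].
  have {outT TL} := subset_trans outT TL.
  elim: outp => [|v outp IH] out; first by exists [::].
  have [|k kv] := out v; first by exists 0.
  have [|addr addrE] := IH; first by move=> w [j jw]; apply: out; exists j.+1.
  by exists (k :: addr); rewrite /= kv addrE.
exists (Slp c addr); split=> // i; exists (mem_at (inp ++ ext) i) => //=.
have := congr1 (map (omap (fun v => FracField.tofrac (v i)))) addrE.
rewrite -!map_comp => addrE'; apply: etrans addrE'.
by apply: eq_map => k; rewrite /= onth_map.
Qed.

End Computability.

(** * Arithmetic in A on coordinates; the degree of F is written [d.+1] *)

Lemma coef_qX_mul (R : comNzRingType) (F : {poly R}) d (x : {poly %/ F}) j :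
  F \is monic -> size F = d.+2 -> (j < d.+1)%N ->
  ('qX * x : {poly %/ F})`_j =
  (if j is j'.+1 then (x : {poly R})`_j' else 0) - (x : {poly R})`_d * F`_j.
Proof.
move=> F_monic F_size lt_jd.
have FE : mk_monic F = F by rewrite /mk_monic F_size F_monic.
have x_size : (size (x : {poly R}) <= d.+1)%N.
  by rewrite -ltnS (leq_trans (size_mk_monic x)) // FE F_size.
have -> : 'qX * x = in_qpoly F ('X * (x : {poly R})).
  rewrite (rmorphM (in_qpoly F)); congr (_ * _).
  by apply/val_inj/esym/in_qpoly_small/size_mk_monic.
move: (x : {poly R}) x_size => {}x x_size.
pose r := 'X * x - (x`_d)%:P * F.
have F_d : F`_d.+1 = 1 by move/monicP: F_monic; rewrite /lead_coef F_size.
have r_size : (size r < size F)%N.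
  rewrite F_size ltnS; apply/leq_sizeP => l; rewrite coefB coefXM coefCM.
  rewrite leq_eqVlt => /predU1P[<-|lt_dl]; first by rewrite F_d mulr1 subrr.
  rewrite [F`_l]nth_default ?F_size // mulr0 subr0; case: l lt_dl => //= l lt_dl.
  by rewrite nth_default // (leq_trans x_size).
have -> : 'X * x = (x`_d)%:P * F + r by rewrite addrC subrK.
rewrite /= FE Pdiv.RingMonic.rmodp_addl_mul_small // coefB coefXM coefCM.
by case: j lt_jd.
Qed.

Lemma qpoly_coefE (R : comNzRingType) (F : {poly R}) n (x : {poly %/ F}) :
  (size (x : {poly R}) <= n)%N -> x = \sum_(j < n) (x : {poly R})`_j *: 'qX ^+ j.
Proof.
move=> x_size; transitivity (in_qpoly F (x : {poly R})).
  by apply/val_inj/esym/in_qpoly_small/size_mk_monic.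
have xE : (x : {poly R}) = \sum_(j < n) (x : {poly R})`_j *: 'X^j.
  rewrite -poly_def; apply/polyP => j; rewrite coef_poly; case: ltnP => // le_nj.
  by rewrite nth_default // (leq_trans x_size).
rewrite {1}xE linear_sum; apply: eq_bigr => j _.
rewrite linearZ; congr (_ *: _). apply: (rmorphXn (in_qpoly F)).
Qed.

Section QuotientArithmetic.
Local Open Scope classical_set_scope.
Variables (R : idomainType) (I : Type) (d : nat) (F : I -> {poly R}).
Hypotheses (F_monic : forall i, F i \is monic) (F_size : forall i, size (F i) = d.+2).
Local Notation V := (I -> R).
Local Notation A i := {poly %/ (F i)}.
Implicit Types (S T : set V) (a b : forall i, A i).

Definition vec n (f : nat -> V) : set V := [set v | exists2 j, (j < n)%N & v = f j].

Definition coefs a : set V := vec d.+1 (fun j i => (a i : {poly R})`_j).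

(** The constants 0 and 1 are part of the context so that they are paid for once, by
    [computable_consts]. *)
Definition has_modulus S :=
  [/\ S (fun=> 0), S (fun=> 1) & vec d.+1 (fun j i => (F i)`_j) `<=` S].

Lemma size_coefs i (x : A i) : (size (x : {poly R}) <= d.+1)%N.
Proof.
by rewrite -ltnS (leq_trans (size_mk_monic x)) // /mk_monic F_size F_monic /= F_size.
Qed.

Lemma has_modulusU S T : has_modulus S -> has_modulus (S `|` T).
Proof. by case=> S0 S1 SF; split; [left | left | move=> v /SF; left]. Qed.

Lemma computable_vec n N S (f : nat -> V) :
  (forall j, (j < n)%N -> computable N S [set f j]) -> computable (n * N) S (vec n f).
Proof.
move=> cf; apply: computable_weaken (computable_bigcup cf) => //.
Qed.

Lemma coefs_mem S a j : coefs a `<=` S -> (j < d.+1)%N ->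
  S (fun i => (a i : {poly R})`_j).
Proof. by move=> aS lt_jd; apply: aS; exists j. Qed.

Lemma computable_coef S a j : coefs a `<=` S -> (j < d.+1)%N ->
  computable 0 S [set fun i => (a i : {poly R})`_j].
Proof. by move=> aS lt_jd; apply: computable_mem; exact: coefs_mem aS lt_jd. Qed.

Lemma computable_coefs N S a (f : nat -> V) :
  (forall i j, (j < d.+1)%N -> (a i : {poly R})`_j = f j i) ->
  (forall j, (j < d.+1)%N -> computable N S [set f j]) ->
  computable (d.+1 * N) S (coefs a).
Proof.
move=> af cf; apply: computable_weaken (computable_vec cf) => //.
by move=> v [j lt_jd ->]; exists j => //; apply/funext => i; apply: af.
Qed.

Lemma computable_qX_mul S a : has_modulus S -> coefs a `<=` S ->
  computable (d.+1 * 2) S (coefs (fun i => 'qX * a i)).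
Proof.
move=> [S0 S1 SF] aS; apply: (@computable_coefs _ _ _
   (fun j i => (if j is j'.+1 then (a i : {poly R})`_j' else 0)
                - (a i : {poly R})`_d * (F i)`_j)) => [i j lt_jd|j lt_jd].
  exact: coef_qX_mul.
apply: (@computable_sub2 _ _ 0 1).
  case: j lt_jd => [|j] lt_jd; first exact: computable_mem.
  exact: computable_coef aS (ltnW _).
apply: (@computable_mul _ _ 0 0); first exact: computable_coef.
by apply/computable_mem/SF; exists j.
Qed.

Lemma computable_mul_add S (c : V) a b : S c -> coefs a `<=` S -> coefs b `<=` S ->
  computable (d.+1 * 2) S (coefs (fun i => b i + c i *: a i)).
Proof.
move=> Sc aS bS; apply: (@computable_coefs _ _ _
   (fun j i => (b i : {poly R})`_j + c i * (a i : {poly R})`_j)) => [i j _|j lt_jd].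
  by rewrite coefD coefZ.
apply: (@computable_add _ _ 0 1); first exact: computable_coef.
by apply: (@computable_mul _ _ 0 0); [apply: computable_mem | apply: computable_coef].
Qed.

(** Each of the [d.+1] Horner rounds uses, per coordinate, two operations to multiply by X and two
    to add a multiple of a. *)
Definition mul_cost := (d.+1 * (d.+1 * 4))%N.

(* Horner evaluation of b at 'qX, starting from the leading coefficient.       *)
Lemma computable_qmul S a b : has_modulus S -> coefs a `<=` S -> coefs b `<=` S ->
  computable mul_cost S (coefs (fun i => a i * b i)).
Proof.
move=> SB aS bS.
pose acc k i : A i :=
  (\sum_(j < k) (b i : {poly R})`_(d.+1 - k + j) *: 'qX ^+ j) * a i.
have acc0 : coefs (acc 0%N) `<=` S.
  move=> v [j lt_jd ->]; have [S0 _ _] := SB.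
  by rewrite (_ : (fun i => _) = fun=> 0) //; apply/funext => i;
     rewrite /acc big_ord0 mul0r coef0.
have accS k i : (k < d.+1)%N ->
    acc k.+1 i = 'qX * acc k i + (b i : {poly R})`_(d - k) *: a i.
  move=> lt_kd; rewrite /acc big_ord_recl mulrDl addrC expr0 -scalerAl mul1r.
  rewrite subSS addn0; congr (_ + _); rewrite mulrA; congr (_ * _).
  rewrite mulr_sumr; apply: eq_bigr => j _.
  rewrite -scalerAr -exprS lift0; congr (nth _ _ _ *: _).
  by rewrite addnS -addSn -subSn.
have stepP k : (k < d.+1)%N ->
    computable (d.+1 * 4) (S `|` coefs (acc k)) (coefs (acc k.+1)).
  move=> lt_kd; have SBk := has_modulusU (coefs (acc k)) SB.
  have Sk : S `<=` S `|` coefs (acc k) by left.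
  have -> : acc k.+1 = fun i => 'qX * acc k i + (b i : {poly R})`_(d - k) *: a i.
    by apply: functional_extensionality_dep => i; apply: accS.
  rewrite (_ : 4 = 2 + 2)%N // mulnDr.
  apply: computable_bind (computable_qX_mul SBk (@subsetUr _ _ _)) _.
  apply: computable_mul_add => [|v av|]; last exact: subsetUr.
    by left; left; apply: (coefs_mem bS); rewrite ltnS leq_subr.
  by left; left; apply: aS.
have accE i : acc d.+1 i = a i * b i.
  by rewrite /acc subnn [RHS]mulrC [in RHS](qpoly_coefE (size_coefs (b i))).
have := computable_iter stepP; apply: computable_weaken => //.
  by rewrite subUset; split.
move=> v [j lt_jd ->]; exists d.+1 => //; exists j => //; apply/funext => i.
by rewrite accE.
Qed.

Lemma computable_qone S : has_modulus S -> computable 0 S (coefs (fun i => 1)).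
Proof.
move=> [S0 S1 _]; rewrite -(muln0 d.+1).
apply: (@computable_coefs _ _ _ (fun j i => (j == 0)%N%:R)) => [i j _|j _].
  by rewrite coefC; case: j.
by case: j => [|j]; apply: computable_mem.
Qed.

(** Binary exponentiation: at most two products for each of the k bits. *)
Lemma computable_qexp k m S a : has_modulus S -> coefs a `<=` S -> (m < 2 ^ k)%N ->
  computable (k * (2 * mul_cost)) S (coefs (fun i => a i ^+ m)).
Proof.
move=> SB aS; elim: k m => [|k IHk] m.
  by rewrite expn0 ltnS leqn0 => /eqP->; apply: computable_qone.
move=> lt_m; have lt_h : (m./2 < 2 ^ k)%N by rewrite ltn_half_double -mul2n -expnS.
rewrite mulSn addnC; apply: computable_bind (IHk _ lt_h) _.
set h := fun i => a i ^+ m./2; set S' := S `|` coefs h.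
have SB' : has_modulus S' := has_modulusU _ SB.
rewrite mul2n -addnn.
apply: computable_bind (computable_qmul SB' (@subsetUr _ _ _) (@subsetUr _ _ _)) _.
set h2 := fun i => h i * h i; set S'' := S' `|` coefs h2.
have hE i : a i ^+ m = (if odd m then a i else 1) * h2 i.
  rewrite /h2 /h -expr2 -exprM muln2 -[in LHS](odd_double_half m) exprD.
  by case: odd => //=; rewrite expr1.
case: (odd m) hE => hE.
  rewrite (_ : (fun i => _) = fun i => a i * h2 i); last first.
    by apply: functional_extensionality_dep => i; apply: hE.
  apply: computable_qmul; first exact: has_modulusU.
    by move=> v /aS Sv; left; left.
  exact: subsetUr.
rewrite (_ : (fun i => _) = h2); last first.
  by apply: functional_extensionality_dep => i; rewrite hE mul1r.
by apply: computable_leq (computable_sub _) => //; apply: subsetUr.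
Qed.

Lemma computable_natr k m S : S (fun=> 0) -> S (fun=> 1) -> (m < 2 ^ k)%N ->
  computable (k * 2) S [set fun=> m%:R].
Proof.
move=> S0 S1; elim: k m => [|k IHk] m.
  by rewrite expn0 ltnS leqn0 => /eqP->; apply: computable_mem.
move=> lt_m; have lt_h : (m./2 < 2 ^ k)%N by rewrite ltn_half_double -mul2n -expnS.
rewrite mulSn addnC; apply: computable_bind (IHk _ lt_h) _.
set h : V := fun=> m./2%:R.
have -> : (fun=> m%:R) = (fun i => (odd m)%:R + (h i + h i)) :> V.
  by apply/funext => i; rewrite /h -natrD addnn -natrD odd_double_half.
apply: (@computable_add _ _ 0 1 _ (fun=> (odd m)%:R) (fun i => h i + h i)); last first.
  by apply: (@computable_add _ _ 0 0); apply: computable_mem; right.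
by apply: computable_mem; left; case: odd.
Qed.

Lemma coef_qone i j : (1 : A i)`_j = (j == 0)%N%:R :> R.
Proof. by rewrite coefC; case: j. Qed.

Lemma computable_consts S : computable 2 S ([set fun=> 1] `|` [set fun=> 0]).
Proof.
apply: (@computable_trans _ _ 1 1); first exact: computable_one.
rewrite (_ : (fun=> 0) = (fun i => (fun=> 1) i - (fun=> 1) i) :> V); last first.
  by apply/funext => i; rewrite subrr.
by apply: (@computable_sub2 _ _ 0 0); apply: computable_mem; right.
Qed.

(** The power a^s, two products, and per coordinate 1 operation for a^s - 1, 2 for 2 - a^s and 2 for
    the final combination. *)
Definition newton_cost k := (k * (2 * mul_cost) + (2 * mul_cost + d.+1 * 5))%N.

Lemma computable_newton_step k s S a (t := (s%:R : R)^-1) :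
  has_modulus S -> S (fun=> t) -> coefs a `<=` S -> (s < 2 ^ k)%N ->
  computable (newton_cost k) S
    (coefs (fun i => newton_step s (a i))).
Proof.
move=> SB St aS lt_s; have [S0 S1 _] := SB.
have S10 j : S (fun=> (j == 0)%N%:R) by case: eqP.
rewrite /newton_cost (_ : 5 = 1 + (2 + 2))%N // 2!mulnDr.
rewrite (_ : 2 * mul_cost + (d.+1 * 1 + (d.+1 * 2 + d.+1 * 2)) =
  d.+1 * 1 + (d.+1 * 2 + (mul_cost + (mul_cost + d.+1 * 2))))%N; last by lia.
apply: computable_bind (computable_qexp SB aS lt_s) _.
set P := fun i => a i ^+ s; set Sp := _ `|` coefs P.
have SSp : S `<=` Sp by left.
pose e i := P i - 1; pose u i := 2 - P i.
apply: (@computable_bind _ _ _ _ _ (coefs e)).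
  apply: (@computable_coefs _ _ _ (fun j i => (P i : {poly R})`_j - (j == 0)%N%:R)).
    by move=> i j _; rewrite coefB coef_qone.
  move=> j lt_jd; apply: (@computable_sub2 _ _ 0 0); last exact/computable_mem/SSp.
  by apply: computable_coef lt_jd; apply: subsetUr.
set Se := _ `|` coefs e; have SSe : Sp `<=` Se by left.
apply: (@computable_bind _ _ _ _ _ (coefs u)).
  apply: (@computable_coefs _ _ _
     (fun j i => ((j == 0)%N%:R + (j == 0)%N%:R) - (P i : {poly R})`_j)).
    by move=> i j _; rewrite coefB coefD coef_qone.
  move=> j lt_jd; apply: (@computable_sub2 _ _ 1 0).
    by apply: (@computable_add _ _ 0 0); apply/computable_mem/SSe/SSp.
  by apply: computable_coef lt_jd => v Pv; apply: SSe; right.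
set Su := _ `|` coefs u; have SSu : Se `<=` Su by left.
have SBu : has_modulus Su by do 3!apply: has_modulusU.
apply: (@computable_bind _ _ _ _ _ (coefs (fun i => e i * a i))).
  apply: computable_qmul => //; first by move=> v ev; apply: SSu; right.
  by move=> v /aS Sv; apply/SSu/SSe/SSp.
set Sea := _ `|` coefs _; have SSea : Su `<=` Sea by left.
apply: (@computable_bind _ _ _ _ _ (coefs (fun i => e i * a i * u i))).
  apply: computable_qmul; [exact: has_modulusU | exact: subsetUr |].
  by move=> v uv; apply: SSea; right.
set Sw := _ `|` coefs _; have SSw : Sea `<=` Sw by left.
apply: (@computable_coefs _ _ _
   (fun j i => (a i : {poly R})`_j - t * (e i * a i * u i : {poly R})`_j)).
  by move=> i j _; rewrite coefB coefZ.
move=> j lt_jd; apply: (@computable_sub2 _ _ 0 1).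
  by apply: computable_coef lt_jd => v /aS Sv; apply/SSw/SSea/SSu/SSe/SSp.
apply: (@computable_mul _ _ 0 0); first exact/computable_mem/SSw/SSea/SSu/SSe/SSp.
by apply: computable_coef lt_jd; apply: subsetUr.
Qed.

Lemma computable_newton n k s : (s%:R : R) \is a GRing.unit -> (s < 2 ^ k)%N ->
  computable (2 + (k * 2 + (1 + (d.+1 * 2 + n * newton_cost k))))
    (vec d.+1 (fun j i => (F i)`_j))
    [set v | exists2 l, (l <= n)%N & coefs (fun i => newton_iter (F i) s l) v].
Proof.
move=> sU lt_s; set S := vec _ _.
apply: computable_bind (@computable_consts S) _; set S1 := S `|` _.
have SB1 : has_modulus S1 by split; [right; right | right; left | left].
have [S10 S11 _] := SB1.
apply: computable_bind (computable_natr S10 S11 lt_s) _; set S2 := S1 `|` _.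
have SB2 : has_modulus S2 by apply: has_modulusU.
apply: (@computable_bind _ _ _ _ _ [set fun=> (s%:R : R)^-1]).
  rewrite (_ : (fun=> _) = (fun i => (fun=> 1) i / (fun=> s%:R) i) :> V); last first.
    by apply/funext => i; rewrite div1r.
  apply: (@computable_div _ _ 0 0) => //; apply: computable_mem; last by right.
  by left.
set S3 := S2 `|` _; have SB3 : has_modulus S3 by apply: has_modulusU.
(* X is computed as X * 1, which also covers degree 1, where X is not a basis element. *)
apply: (@computable_bind _ _ _ _ _ (coefs (fun i => newton_iter (F i) s 0))).
  have := computable_bind (computable_qone SB3)
    (computable_qX_mul (has_modulusU _ SB3) (@subsetUr _ _ _)).
  rewrite add0n (_ : (fun i => newton_iter (F i) s 0) = fun i => 'qX * 1) //.
  by apply: functional_extensionality_dep => i; rewrite mulr1.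
apply: computable_iter => l _; apply: computable_newton_step lt_s.
- exact: has_modulusU.
- by left; right.
- exact: subsetUr.
Qed.

Lemma computable_pow_iter n k q a : (q < 2 ^ k)%N ->
  computable (2 + n * (k * (2 * mul_cost)))
    (vec d.+1 (fun j i => (F i)`_j) `|` coefs a)
    [set v | exists2 l, (l <= n)%N & coefs (fun i => a i ^+ (q ^ l)) v].
Proof.
move=> lt_q; set S := _ `|` _.
apply: computable_bind (@computable_consts S) _; set S1 := S `|` _.
have SB1 : has_modulus S1 by split; [right; right | right; left | left; left].
pose T l := coefs (fun i => a i ^+ (q ^ l)).
have := @computable_iter _ _ n (k * (2 * mul_cost)) S1 T.
have aT0 : T 0 `<=` S1.
  by move=> v [j lt_jd ->]; left; right; exists j.
move=> cT; apply: computable_weaken (cT _) => //; first by rewrite subUset; split.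
move=> l _; rewrite {2}/T.
have -> : (fun i => a i ^+ (q ^ l.+1)) = (fun i => (a i ^+ (q ^ l)) ^+ q).
  by apply: functional_extensionality_dep => i; rewrite -exprM expnS mulnC.
by apply: computable_qexp lt_q; [exact: has_modulusU | exact: subsetUr].
Qed.

End QuotientArithmetic.

(** * Gauss-Jordan elimination *)

Section GaussJordan.
Local Open Scope classical_set_scope.
Variable R : idomainType.
Implicit Type W : nat -> nat -> R.

(** [W l j] is row l, column j of an augmented system whose column n is the right-hand side; the
    pivot is always the diagonal entry. *)
Definition pivot_step k W l j :=
  if l == k then W k j / W k k else W l j - W l k * (W k j / W k k).

Fixpoint gauss_jordan k W :=
  if k is k'.+1 then pivot_step k' (gauss_jordan k' W) else W.

Definition entries (I : Type) n (W : I -> nat -> nat -> R) : set (I -> R) :=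
  [set v | exists2 l, (l < n)%N & vec n.+1 (fun j i => W i l j) v].

Lemma computable_gauss_jordan (I : Type) n (W : I -> nat -> nat -> R) S :
  (forall i k, (k < n)%N -> gauss_jordan k (W i) k k \is a GRing.unit) ->
  entries n W `<=` S ->
  computable (n * (n.+1 * 1 + n * (n.+1 * 2))) S
    (entries n (fun i => gauss_jordan n (W i))).
Proof.
move=> pivotU WS; pose T k := entries n (fun i => gauss_jordan k (W i)).
have stepP k : (k < n)%N ->
    computable (n.+1 * 1 + n * (n.+1 * 2)) (S `|` T k) (T k.+1).
  move=> lt_kn; set Sk := S `|` T k; set Wk := fun i => gauss_jordan k (W i).
  have Tk l j : (l < n)%N -> (j < n.+1)%N -> Sk (fun i => Wk i l j).
    by move=> lt_ln lt_jn; right; exists l => //; exists j.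
  apply: (@computable_bind _ _ _ _ _ (vec n.+1 (fun j i => Wk i k j / Wk i k k))).
    apply: computable_vec => j lt_jn; apply: (@computable_div _ _ 0 0).
    - by move=> i; apply: pivotU.
    - exact/computable_mem/Tk.
    - by apply/computable_mem/Tk => //; apply: ltnW.
  set Sr := _ `|` vec _ _; apply: computable_bigcup => l lt_ln.
  apply: computable_vec => j lt_jn; rewrite /= /pivot_step.
  have Srow : Sr (fun i => Wk i k j / Wk i k k) by right; exists j.
  case: eqP => _; first exact: computable_leq (computable_mem Srow).
  apply: (@computable_sub2 _ _ 0 1); first by apply: computable_mem; left; apply: Tk.
  apply: (@computable_mul _ _ 0 0); last exact: computable_mem.
  by apply: computable_mem; left; apply: Tk => //; apply: ltnW.
have := computable_iter stepP; apply: computable_weaken => //.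
  by rewrite subUset; split.
by move=> v Tv; exists n.
Qed.

End GaussJordan.

Section GaussJordanCorrectness.

(** Invariant: c still solves the system and the first k columns are those of the identity. *)
Lemma gauss_jordan_solves (R : idomainType) n (W : nat -> nat -> R) (c : nat -> R) :
  (forall k, (k < n)%N -> gauss_jordan k W k k \is a GRing.unit) ->
  (forall l, (l < n)%N -> \sum_(j < n) W l j * c j = W l n) ->
  forall l, (l < n)%N -> gauss_jordan n W l n = c l.
Proof.
move=> pivotU Wc.
suff inv k : (k <= n)%N -> forall l, (l < n)%N ->
    \sum_(j < n) gauss_jordan k W l j * c j = gauss_jordan k W l n /\
    (forall j, (j < k)%N -> gauss_jordan k W l j = (l == j)%:R).
  move=> l lt_ln; have [<- WI] := inv n (leqnn n) l lt_ln.
  rewrite (bigD1 (Ordinal lt_ln)) //= WI // eqxx mul1r big1 ?addr0 // => j.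
  by rewrite -val_eqE /= eq_sym => /negPf lj; rewrite WI // lj mul0r.
elim: k => [_ l lt_ln|k IHk lt_kn]; first by split; [apply: Wc|].
set U := gauss_jordan k W in IHk *; have {}IHk := IHk (ltnW lt_kn).
have [Uk_c Uk_I] := IHk k lt_kn; have Ukk := pivotU k lt_kn; rewrite -/U in Ukk.
have row_c : \sum_(j < n) (U k j / U k k) * c j = U k n / U k k.
  by rewrite -Uk_c mulr_suml; apply: eq_bigr => j _; rewrite mulrAC.
move=> l lt_ln; have [Ul_c Ul_I] := IHk l lt_ln; rewrite /= -/U /pivot_step.
case: eqP => [->|/eqP ne_lk]; split=> [|j] //.
- rewrite ltnS leq_eqVlt => /predU1P[->|lt_jk]; first by rewrite eqxx divrr.
  by rewrite Uk_I // gtn_eqF // mul0r.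
- under eq_bigr do rewrite mulrBl -mulrA.
  by rewrite sumrB -mulr_sumr row_c Ul_c.
rewrite ltnS leq_eqVlt => /predU1P[->|lt_jk].
  by rewrite divrr // mulr1 subrr (negPf ne_lk).
by rewrite Uk_I // gtn_eqF // mul0r mulr0 subr0 Ul_I.
Qed.

(** Pivot steps preserve being the identity modulo p, so every pivot is a unit. *)
Lemma gauss_jordan_reduction p (p_pr : prime p) n (W : nat -> nat -> padic_int p_pr) :
  (forall l j, (l < n)%N -> (j < n)%N -> reduction (W l j) = (l == j)%:R) ->
  forall k, (k <= n)%N -> forall l j, (l < n)%N -> (j < n)%N ->
  reduction (gauss_jordan k W l j) = (l == j)%:R.
Proof.
move=> WI; elim=> [|k IHk] // lt_kn l j lt_ln lt_jn; have {}IHk := IHk (ltnW lt_kn).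
set U := gauss_jordan k W in IHk *; rewrite /= -/U /pivot_step.
have Ukk : U k k \is a GRing.unit.
  by rewrite padic_unit_reduction // IHk // eqxx oner_neq0.
have row_red : reduction (U k j / U k k) = (k == j)%:R.
  by rewrite rmorphM rmorphV //= !IHk // eqxx divr1.
case: eqP => [->|/eqP ne_lk]; first exact: row_red.
by rewrite rmorphB rmorphM /= row_red !IHk // (negPf ne_lk) mul0r subr0.
Qed.

End GaussJordanCorrectness.

Section Stores.
Local Open Scope classical_set_scope.
Variables (R : idomainType) (I : Type).
Local Notation V := (I -> R).

Lemma storesP (L : seq V) v : stores L v <-> v \in (L : seq V).
Proof. by split => /onthP. Qed.

Lemma stores_map (f : nat -> V) m n v :
  stores [seq f j | j <- iota m n] v <-> exists2 j, (m <= j < m + n)%N & v = f j.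
Proof.
rewrite storesP; split=> [/mapP[j]|[j j_mn ->]].
  by rewrite mem_iota => j_mn ->; exists j.
by apply/mapP; exists j; rewrite ?mem_iota.
Qed.

Lemma stores_flatten (f : nat -> seq V) m n v :
  stores (flatten [seq f k | k <- iota m n]) v <->
  exists2 k, (m <= k < m + n)%N & stores (f k) v.
Proof.
rewrite storesP; split=> [/flatten_mapP[k]|[k k_mn /storesP fv]].
  by rewrite mem_iota => k_mn fv; exists k => //; apply/storesP.
by apply/flatten_mapP; exists k; rewrite ?mem_iota.
Qed.

Lemma stores_cat (L L' : seq V) : stores (L ++ L') = stores L `|` stores L'.
Proof.
apply/seteqP; split=> v; rewrite /setU /= !storesP mem_cat => /orP //.
Qed.

Lemma mem_at_flatten (f : nat -> seq V) ks i :
  mem_at (flatten [seq f k | k <- ks]) i = flatten [seq mem_at (f k) i | k <- ks].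
Proof. by rewrite /mem_at map_flatten -map_comp. Qed.

End Stores.

(** * The three programs *)

Section Programs.
Local Open Scope classical_set_scope.
Variables (p : nat) (p_pr : prime p).
Local Notation Zp := (padic_int p_pr).

Lemma newton_slp s d n k : ~~ (p %| s)%N -> (s < 2 ^ k)%N ->
  exists P : slp,
    (cost P <= 2 + (k * 2 + (1 + (d.+1 * 2 + n * newton_cost d k))))%N /\
    forall F : {poly Zp}, F \is monic -> size F = d.+2 ->
      computes P (coords d.+1 F)
        (flatten [seq coords d.+1 (newton_iter F s i) | i <- iota 1 n]).
Proof.
move=> ps lt_sk; pose I := {F : {poly Zp} | F \is monic /\ size F = d.+2}.
pose F (i : I) := sval i.
have F_monic i : F i \is monic by case: (svalP i).
have F_size i : size (F i) = d.+2 by case: (svalP i).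
pose inp := [seq (fun i => (F i)`_j) | j <- iota 0 d.+1].
pose outp := flatten [seq [seq (fun i => (newton_iter (F i) s l : {poly Zp})`_j)
                            | j <- iota 0 d.+1] | l <- iota 1 n].
have [||P [P_cost PP]] := @computable_slp _ _ _ _ _ inp outp _ _
    (computable_newton F_monic F_size n (padic_unit_natr p_pr ps) lt_sk).
- by move=> v [j lt_jd ->]; apply/stores_map; exists j.
- move=> v /stores_flatten[l /andP[_ lt_ln] /stores_map[j lt_jd ->]].
  by exists l; rewrite ?add1n // in lt_ln *; exists j.
exists P; split=> // F0 F0_monic F0_size.
have := PP (exist _ F0 (conj F0_monic F0_size)).
rewrite mem_at_flatten /mem_at -map_comp; congr (computes _ _ (flatten _)).
by apply: eq_map => l; rewrite -map_comp.
Qed.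

Record quotient_elt d := QuotientElt {
  modulus : {poly Zp};
  elt : {poly %/ modulus};
  modulusP : modulus \is monic /\ size modulus = d.+2 }.

Lemma powers_slp q d k : (q < 2 ^ k)%N ->
  exists P : slp,
    (cost P <= 2 + d * (k * (2 * mul_cost d)))%N /\
    forall (F : {poly Zp}) (a : {poly %/ F}), F \is monic -> size F = d.+2 ->
      computes P (coords d.+1 F ++ coords d.+1 a)
        (flatten [seq coords d.+1 (a ^+ (q ^ i)) | i <- iota 1 d]).
Proof.
move=> lt_qk; pose I := quotient_elt d.
have F_monic (i : I) : modulus i \is monic by case: (modulusP i).
have F_size (i : I) : size (modulus i) = d.+2 by case: (modulusP i).
pose inp := [seq (fun i : I => (modulus i)`_j) | j <- iota 0 d.+1] ++
  [seq (fun i : I => (elt i : {poly Zp})`_j) | j <- iota 0 d.+1].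
pose outp := flatten [seq [seq (fun i : I => (elt i ^+ (q ^ l) : {poly Zp})`_j)
                            | j <- iota 0 d.+1] | l <- iota 1 d].
have [||P [P_cost PP]] := @computable_slp _ _ _ _ _ inp outp _ _
    (computable_pow_iter F_monic F_size d (a := @elt d) lt_qk).
- rewrite stores_cat.
  by move=> v [] [j lt_jd ->]; [left | right]; apply/stores_map; exists j.
- move=> v /stores_flatten[l /andP[_ lt_ln] /stores_map[j lt_jd ->]].
  by exists l; rewrite ?add1n // in lt_ln *; exists j.
exists P; split=> // F0 a F0_monic F0_size.
have := PP (@QuotientElt d F0 a (conj F0_monic F0_size)).
rewrite mem_at_flatten /mem_at map_cat -!map_comp; congr (computes _ _ (flatten _)).
by apply: eq_map => l; rewrite -map_comp.
Qed.

(** The environment of the expansion program; its proof field is what makes all pivots units. *)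
Record lift_elt d := LiftElt {
  lift_modulus : {poly Zp};
  root_elt : {poly %/ lift_modulus};
  lift_eltP : exists2 fbar : {poly 'F_p},
    [/\ fbar \is monic, irreducible_poly fbar & size fbar = d.+2]
    & [/\ lift_modulus \is monic, map_poly (@reduction p p_pr) lift_modulus = fbar
      & congr_mod p%:R root_elt 'qX] }.

(** Constants, the powers of a up to exponent [d.+1], the elimination, then one operation per output
    coordinate. *)
Definition expand_cost d : nat :=
  2 + (d.+1 * mul_cost d +
       (d.+1 * (d.+2 * 1 + d.+1 * (d.+2 * 2)) + d.+2 * (d.+1 * 1))).

Lemma expand_slp q d : exists P : slp, (cost P <= expand_cost d)%N /\
  forall (fbar : {poly 'F_p}) (F : {poly Zp}) (a : {poly %/ F}),
    fbar \is monic -> irreducible_poly fbar -> size fbar = d.+2 ->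
    F \is monic -> map_poly (@reduction p p_pr) F = fbar ->
    congr_mod p%:R a 'qX ->
    exists G : {poly Zp}, [/\ G \is monic, size G = d.+2,
      (map_poly (qpolyC F) G).[a] = 0 &
      computes P
        (coords d.+1 F ++
         flatten [seq coords d.+1 (a ^+ (q ^ i)) | i <- iota 0 d.+1])
        (flatten [seq coords d.+1 (map_poly (qpolyC F) G)`_k | k <- iota 0 d.+2])].
Proof.
pose I := lift_elt d; pose F (i : I) := lift_modulus i; pose a (i : I) := root_elt i.
have F_monic i : F i \is monic by have [? _ []] := lift_eltP i.
have F_size i : size (F i) = d.+2.
  have [fbar [fm fi fs] [Fm Fr _]] := lift_eltP i.
  exact: size_lift fs Fm Fr.
have /choice[g gP] i : exists g : {poly Zp}, (size g <= d.+1)%N /\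
    (map_poly (qpolyC (F i)) g).[a i] = a i ^+ d.+1.
  have [fbar [fm fi fs] [Fm Fr aX]] := lift_eltP i.
  by have [g gs ga] := ev_surj fi fs Fm Fr (a i ^+ d.+1) aX; exists g.
pose G i : {poly Zp} := 'X^(d.+1) - g i.
have G_coef i k : (k <= d.+1)%N -> (G i)`_k = if (k == d.+1)%N then 1 else 0 - (g i)`_k.
  rewrite leq_eqVlt /G coefB coefXn => /predU1P[->|lt_kd].
    by rewrite eqxx nth_default ?subr0 //; case: (gP i).
  by rewrite ltn_eqF.
(* The transpose of [power_mx], with the coordinates of a^(d+1) as right-hand side: its solution is
   g. *)
pose W i l j : Zp := (a i ^+ j : {poly Zp})`_l.
pose inp := [seq (fun i => (F i)`_j) | j <- iota 0 d.+1] ++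
  flatten [seq [seq (fun i => (a i ^+ (q ^ l) : {poly Zp})`_j)
                            | j <- iota 0 d.+1] | l <- iota 0 d.+1].
pose out k j i : Zp := (qpolyC (F i) (G i)`_k : {poly Zp})`_j.
pose outp := flatten [seq [seq out k j | j <- iota 0 d.+1] | k <- iota 0 d.+2].
pose S0 : set (I -> Zp) := vec d.+1 (fun j i => (F i)`_j) `|` coefs d a.
pose T : set (I -> Zp) := [set v | exists2 k, (k < d.+2)%N & vec d.+1 (out k) v].
have W_red i l j : (l < d.+1)%N -> (j < d.+1)%N -> reduction (W i l j) = (l == j)%:R.
  move=> lt_ld lt_jd; have [fbar [fm fi fs] [Fm Fr aX]] := lift_eltP i.
  rewrite -(rmorph_nat (@reduction p p_pr)); apply/reduction_eqP.
  exact: (power_mx_congr fi fs Fm Fr).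
have pivotU i k : (k < d.+1)%N -> gauss_jordan k (W i) k k \is a GRing.unit.
  move=> lt_kd; rewrite padic_unit_reduction //.
  by rewrite (gauss_jordan_reduction (W_red i) (ltnW lt_kd)) // eqxx oner_neq0.
have g_solves i l : (l < d.+1)%N -> gauss_jordan d.+1 (W i) l d.+1 = (g i)`_l.
  apply: gauss_jordan_solves => [k lt_kd|{}l lt_ld]; first exact: pivotU.
  have [g_d ga] := gP i; rewrite /W -ga (coef_horner_qpoly _ _ g_d).
  by apply: eq_bigr => j _; rewrite mulrC.
have cT : computable (expand_cost d) S0 T.
  apply: computable_bind (@computable_consts _ _ _) _; set S1 := S0 `|` _.
  have SB1 : has_modulus d F S1.
    by split; [right; right | right; left | left; left].
  pose Tp j : set (I -> Zp) := coefs d (fun i => a i ^+ j).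
  apply: (@computable_bind _ _ _ _ _ [set v | exists2 j, (j <= d.+1)%N & Tp j v]).
    have stepP j : (j < d.+1)%N -> computable (mul_cost d) (S1 `|` Tp j) (Tp j.+1).
      move=> _; rewrite {2}/Tp.
      have -> : (fun i => a i ^+ j.+1) = fun i => a i * a i ^+ j.
        by apply: functional_extensionality_dep => i; rewrite exprS.
      apply: computable_qmul => //; first exact: has_modulusU.
      by move=> v av; left; left; right.
    have := computable_iter stepP; apply: computable_weaken => // v [//|].
    move=> [j lt_jd ->]; have [S10 S11 _] := SB1.
    rewrite (_ : (fun i => _) = fun=> (j == 0)%N%:R); first by case: (j == 0)%N.
    by apply/funext => i; rewrite expr0 coef_qone.
  set S2 := _ `|` _.
  apply: (computable_bind (@computable_gauss_jordan _ I d.+1 W S2 _ _)).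
  - by move=> i k; apply: pivotU.
  - by move=> v [l lt_ld [j lt_jd ->]]; right; exists j => //; exists l.
  set S3 := _ `|` _; apply: computable_bigcup => k; rewrite ltnS => le_kd.
  apply: computable_vec => j lt_jd.
  have [S30 S31 _] : has_modulus d F S3 by do 2!apply: has_modulusU.
  (* The coefficients of G are constants of A, so only coordinate 0 can be nonzero. *)
  have outE i : out k j i =
      if (j == 0)%N then (if (k == d.+1)%N then 1 else 0 - (g i)`_k) else 0.
    by rewrite /out qpolyCE coefC G_coef.
  rewrite (funext outE); case: (j == 0)%N; last first.
    exact: computable_leq (computable_mem S30).
  case: eqP => [_|/eqP ne_kd]; first exact: computable_leq (computable_mem S31).
  have lt_kd : (k < d.+1)%N by rewrite ltn_neqAle ne_kd.
  apply: (@computable_sub2 _ _ 0 0); apply: computable_mem => //.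
  right; exists k => //; exists d.+1 => //.
  by apply/funext => i; rewrite g_solves.
have [||P [P_cost PP]] := @computable_slp _ _ _ _ _ inp outp _ _ cT.
- rewrite stores_cat => v [[j lt_jd ->]|[j lt_jd ->]]; [left | right].
    by apply/stores_map; exists j.
  by apply/stores_flatten; exists 0%N => //; apply/stores_map; exists j.
- move=> v /stores_flatten[k lt_kd /stores_map[j lt_jd ->]].
  by exists k => //; exists j.
exists P; split=> // fbar F0 a0 fm fi fs F0m F0r a0X.
pose i := @LiftElt d F0 a0 (ex_intro2 _ _ fbar (And3 fm fi fs) (And3 F0m F0r a0X)).
have [g_d ga] := gP i.
have lt_gd : (size (- g i) < size ('X^(d.+1) : {poly Zp}))%N.
  by rewrite size_polyXn size_polyN ltnS.
exists (G i); split.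
- by rewrite monicE lead_coefDl // lead_coefXn.
- by rewrite size_polyDl // size_polyXn.
- by rewrite rmorphB /= map_polyXn !hornerE ga subrr.
have := PP i; rewrite /inp /outp mem_at_flatten /mem_at map_cat map_flatten -!map_comp.
congr (computes _ (_ ++ flatten _) (flatten _)).
  by apply: eq_map => l /=; rewrite -map_comp.
by apply: eq_map => l /=; rewrite -map_comp /coords coef_map.
Qed.

End Programs.

(** * Uniform choice of programs and cost bounds *)

(** Primality proofs are unique, so a program may depend on p alone; a non-prime p gets an empty
    program. *)
Lemma prime_slp_choice (X : forall p, prime p -> nat -> nat -> nat -> slp -> Prop) :
  (forall p p_pr s d n, exists P, X p p_pr s d n P) ->
  exists prog : nat -> nat -> nat -> nat -> slp,
    forall p p_pr s d n, X p p_pr s d n (prog p s d n).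
Proof.
move=> XP; have /choice[prog progP] (x : nat * nat * nat * nat) :
    exists P, forall p_pr, X x.1.1.1 p_pr x.1.1.2 x.1.2 x.2 P.
  have [p_pr|p_npr] := pselect (prime x.1.1.1).
    have [P XPP] := XP _ p_pr x.1.1.2 x.1.2 x.2; exists P => p_pr'.
    by rewrite (bool_irrelevance p_pr' p_pr).
  by exists (Slp [::] [::]) => p_pr; case: p_npr.
by exists (fun p s d n => prog (p, s, d, n)) => p p_pr s d n; apply: (progP (p, s, d, n)).
Qed.

Lemma trunc_log_le (R : realType) s : (0 < s)%N ->
  (trunc_log 2 s).+1%:R <= ((ln 2)^-1 + 1) * log_max1 R s.
Proof.
move=> s_gt0; have ln2_gt0 : 0 < ln 2 :> R by rewrite ln_gt0 // ltr1n.
rewrite mulrDl mul1r -natr1 lerD ?le_max ?lexx // ler_pdivlMl // mulrC.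
apply: (@le_trans _ _ (ln s%:R)); last by rewrite le_max lexx orbT.
rewrite mulr_natl -lnXn ?ltr0n // ler_ln ?posrE ?exprn_gt0 ?ltr0n //.
by rewrite -natrX ler_nat trunc_logP.
Qed.

(** In units of D^2 n k, with D the degree: 28 = 3 + 2 + 2 + 21, where 21 = 8 + 8 + 5 comes from
    [newton_cost]. *)
Lemma newton_cost_le d n k : (0 < n)%N -> (0 < k)%N ->
  (2 + (k * 2 + (1 + (d.+1 * 2 + n * newton_cost d k))) <= 28 * (d.+1 ^ 2 * n * k))%N.
Proof.
move=> n_gt0 k_gt0; rewrite /newton_cost /mul_cost; set D := d.+1.
have D_gt0 : (0 < D)%N by [].
have n1 : (n <= n * k)%N by rewrite leq_pmulr.
have k1 : (k <= n * k)%N by rewrite leq_pmull.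
have D1 : (D <= D ^ 2)%N by rewrite leq_pmulr.
have : (k <= D ^ 2 * (n * k))%N by rewrite (leq_trans k1) // leq_pmull // expn_gt0.
have : (D <= D ^ 2 * (n * k))%N.
  by rewrite (leq_trans D1) // leq_pmulr // muln_gt0 n_gt0.
have : (D ^ 2 * n <= D ^ 2 * (n * k))%N by rewrite leq_mul.
have : (D * n <= D ^ 2 * (n * k))%N by rewrite leq_mul.
rewrite -mulnA; have : (D * D = D ^ 2)%N by [].
have : (0 < n * k)%N by rewrite muln_gt0 n_gt0.
nia.
Qed.

Lemma powers_cost_le d k : (0 < k)%N ->
  (2 + d * (k * (2 * mul_cost d)) <= 28 * (d.+1 ^ 3 * k))%N.
Proof.
move=> k_gt0; rewrite /mul_cost !expnS expn0; set D := d.+1; have : (d <= D)%N by [].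
have : (0 < D)%N by []; nia.
Qed.

Lemma expand_cost_le d : (expand_cost d <= 28 * d.+1 ^ 3)%N.
Proof.
rewrite /expand_cost /mul_cost !expnS expn0; nia.
Qed.

Theorem mainTheorem3 (R : realType) :
  exists (C : R) (alpha_prog powers_prog expand_prog :
                    nat -> nat -> nat -> nat -> slp),
  forall (p : nat) (p_pr : prime p) (s : nat) (fbar : {poly 'F_p}) (d n : nat)
         (F : {poly padic_int p_pr}),
    (0 < s)%N -> ~~ (p %| s)%N ->
    fbar \is monic -> irreducible_poly fbar ->
    fbar %| map_poly intr 'Phi_s -> size fbar = d.+1 ->
    (0 < n)%N ->
    F \is monic -> map_poly (@reduction p p_pr) F = fbar ->
  [/\ exists ftilde : {poly padic_int p_pr},
        unique (cyclotomic_lift s fbar) ftilde /\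
        forall alpha : nat -> {poly %/ F}, newton_seq s n alpha ->
          congr_mod (p%:R ^+ (2 ^ n)) (conj_prod d (alpha n))
                    (map_poly (qpolyC F) ftilde),
      (cost (alpha_prog p s d n))%:R
        <= C * (d%:R ^+ 2 * n%:R * log_max1 R s) /\
      exists2 alpha : nat -> {poly %/ F}, newton_seq s n alpha &
        computes (alpha_prog p s d n)
          (coords d F)
          (flatten [seq coords d (alpha i) | i <- iota 1 n]),
      (cost (powers_prog p s d n))%:R <= C * (d%:R ^+ 3 * log_max1 R p) /\
      forall alpha : nat -> {poly %/ F}, newton_seq s n alpha ->
        computes (powers_prog p s d n)
          (coords d F ++ coords d (alpha n))
          (flatten [seq coords d (alpha n ^+ (p ^ i)) | i <- iota 1 d.-1])
    & (cost (expand_prog p s d n))%:R <= C * (d%:R ^+ 3 * log_max1 R d) /\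
      forall alpha : nat -> {poly %/ F}, newton_seq s n alpha ->
        exists G : {poly {poly %/ F}},
          [/\ (size G <= d.+1)%N,
              congr_mod (p%:R ^+ (2 ^ n)) G (conj_prod d (alpha n))
            & computes (expand_prog p s d n)
                (coords d F ++
                 flatten [seq coords d (alpha n ^+ (p ^ i)) | i <- iota 0 d])
                (flatten [seq coords d G`_k | k <- iota 0 d.+1])]].
Proof.
pose c : R := (ln 2)^-1 + 1.
have c_ge1 : 1 <= c by rewrite lerDr invr_ge0 ln_ge0 // ler1n.
have log_ge1 m : 1 <= log_max1 R m by rewrite le_max lexx.
have costC (N M k m : nat) : (N <= 28 * (M * k))%N -> k%:R <= c * log_max1 R m ->
    N%:R <= 28 * c * (M%:R * log_max1 R m).
  move=> NM kc; apply: le_trans (_ : (28 * (M * k))%N%:R <= _).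
    by rewrite ler_nat.
  by rewrite !natrM mulrACA -mulrA ler_pM2l ?ltr0n // ler_wpM2l // ler0n.
have [|alpha_prog alphaP] := @prime_slp_choice (fun p p_pr s d n P =>
    ~~ (p %| s)%N -> (0 < d)%N ->
    (cost P <= 2 + ((trunc_log 2 s).+1 * 2
       + (1 + (d * 2 + n * newton_cost d.-1 (trunc_log 2 s).+1))))%N /\
    forall F : {poly padic_int p_pr}, F \is monic -> size F = d.+1 ->
      computes P (coords d F)
        (flatten [seq coords d (newton_iter F s i) | i <- iota 1 n])).
  (* Degree 0 gets a dummy program; fbar, being irreducible, has positive degree. *)
  move=> p p_pr s [|d] n; first by exists (Slp [::] [::]).
  have [/negPf ps|ps] := boolP (p %| s)%N; first by exists (Slp [::] [::]) => /negP.
  by have [P PP] := newton_slp p_pr d n ps (trunc_log_ltn s (leqnn 2)); exists P.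
have [|powers_prog powersP] := @prime_slp_choice (fun p p_pr s d n P =>
    (0 < d)%N ->
    (cost P <= 2 + d.-1 * ((trunc_log 2 p).+1 * (2 * mul_cost d.-1)))%N /\
    forall (F : {poly padic_int p_pr}) (a : {poly %/ F}), F \is monic -> size F = d.+1 ->
      computes P (coords d F ++ coords d a)
        (flatten [seq coords d (a ^+ (p ^ i)) | i <- iota 1 d.-1])).
  move=> p p_pr s [|d] n; first by exists (Slp [::] [::]).
  by have [P PP] := powers_slp p_pr d (trunc_log_ltn p (leqnn 2)); exists P.
have [|expand_prog expandP] := @prime_slp_choice (fun p p_pr s d n P =>
    (0 < d)%N -> (cost P <= expand_cost d.-1)%N /\
    forall (fbar : {poly 'F_p}) (F : {poly padic_int p_pr}) (a : {poly %/ F}),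
    fbar \is monic -> irreducible_poly fbar -> size fbar = d.+1 ->
    F \is monic -> map_poly (@reduction p p_pr) F = fbar ->
    congr_mod p%:R a 'qX ->
    exists G : {poly padic_int p_pr}, [/\ G \is monic, size G = d.+1,
      (map_poly (qpolyC F) G).[a] = 0 &
      computes P
        (coords d F ++ flatten [seq coords d (a ^+ (p ^ i)) | i <- iota 0 d])
        (flatten [seq coords d (map_poly (qpolyC F) G)`_k | k <- iota 0 d.+1])]).
  move=> p p_pr s [|d] n; first by exists (Slp [::] [::]).
  by have [P PP] := expand_slp p_pr p d; exists P.
exists (28 * c), alpha_prog, powers_prog, expand_prog.
move=> p p_pr s fbar d n F s_gt0 ps fm fi fPhi fs n_gt0 Fm Fr.
have d_gt0 := degree_gt0 fi fs; have F_size := size_lift fs Fm Fr.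
have [ft [ft_lift ftP]] := conj_prod_congr_lift s_gt0 ps fm fi fPhi fs Fm Fr.
have [alpha_cost alpha_run] := alphaP p p_pr s d n ps d_gt0.
have [powers_cost powers_run] := powersP p p_pr s d n d_gt0.
have [expand_cst expand_run] := expandP p p_pr s d n d_gt0.
split.
- by exists ft; split=> // alpha /ftP[].
- split; last first.
    exists (newton_iter F s); last exact: alpha_run.
    by split=> // -[|i] // _; apply: congr_mod_refl.
  rewrite -natrX -natrM; apply: costC (trunc_log_le R s_gt0).
  apply: leq_trans alpha_cost _; rewrite -(prednK d_gt0).
  exact: newton_cost_le.
- split=> [|alpha _]; last exact: powers_run.
  rewrite -natrX; apply: costC (trunc_log_le R (prime_gt0 p_pr)).
  apply: leq_trans powers_cost _; rewrite -{3}(prednK d_gt0).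
  exact: powers_cost_le.
split=> [|alpha alphaN].
  (* The program costs O(d^3); the logarithmic factor is at least 1. *)
  rewrite -natrX; apply: (costC _ _ 1%N); last by rewrite -[1]mulr1 ler_pM.
  rewrite muln1; apply: leq_trans expand_cst _; rewrite -{2}(prednK d_gt0).
  exact: expand_cost_le.
have [_ aX] := newton_seq_congr s_gt0 ps fm fi fPhi fs Fm Fr alphaN (leqnn n).
have [G [Gm G_size Ga GP]] := expand_run fbar F (alpha n) fm fi fs Fm Fr aX.
exists (map_poly (qpolyC F) G); split=> //.
  by rewrite -G_size size_poly.
by have [_] := ftP n alpha alphaN; apply.
Qed.
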